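(* Let $b=3/2$ and let $\pi$ be a positive function on $\mathbb N$ with $\pi(0)\ge(1+b)\pi(1)$. The mass migration zero range process (MM-ZRP) with rates $$g^k_\alpha=\pi(1)\,\frac{\prod_{i=\alpha-k}^{\alpha-1}\big(1+\frac bi\big)}{\prod_{i=1}^{k-1}\big(1+\frac bi\big)}\quad\text{for }1\le k<\alpha,\qquad g^\alpha_\alpha=\pi(0)\quad\text{for }\alpha\ge1,$$ (and $g^k_\alpha=0$ for $k>\alpha$) is attractive and exhibits condensation in the second set-up (condensation on a fixed finite volume).
   Context: MM-ZRP: $\mathbb N=\{0,1,\dots\}$; configurations $\eta\in\mathbb N^X$ on a countable set of sites $X$; $k\ge1$ particles jump together from $x$ to $y$ at rate $p(x,y)g^k_{\eta(x)}$, with $p$ an irreducible transition probability on $X$ (bistochastic in the translation-invariant/periodic case). The process is assumed to be constructed, with Markov semigroup $S(t)$, on its state space $\mathfrak X\subset\mathbb N^X$ (automatic for finite $X$). Attractiveness: on $\mathfrak X$, $\eta\le\zeta$ means $\eta(x)\le\zeta(x)$ for all $x\in X$. A bounded continuous $f$ on $\mathfrak X$ is monotone if $f(\eta)\le f(\zeta)$ whenever $\eta\le\zeta$. The process is attractive if for every bounded monotone continuous $f$ and every $t>0$, $S(t)f$ is again bounded, monotone and continuous. Condensation, second set-up: set $\pi_b(0)=\pi(0)$ and $\pi_b(n)=\pi(1)/\prod_{i=1}^{n-1}(1+\frac bi)$ for $n\ge1$, so that $g^k_\alpha=\pi_b(\alpha-k)\pi_b(k)/\pi_b(\alpha)$.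 Let $Z_\varphi=\sum_n\varphi^n\pi_b(n)$, with radius of convergence $\varphi_c$ ($=1$), and let $\mu_\varphi(n)=Z_\varphi^{-1}\varphi^n\pi_b(n)$. For $L\ge2$ sites and $N$ particles, the process restricted to $\Lambda=\{1,\dots,L\}$ with periodic boundary condition has the unique stationary distribution $\mu_{N,L}(\eta)=\bar\mu^\Lambda_\varphi(\eta\mid\sum_{x\in\Lambda}\eta(x)=N)$, $\bar\mu^\Lambda_\varphi$ being the product measure on $\mathbb N^\Lambda$ with marginals $\mu_\varphi$ (this does not depend on $\varphi$). The process exhibits condensation in the second set-up if $\varphi_c<\infty$, $Z_{\varphi_c}<\infty$ and, for each fixed $L\ge2$, $\hat\mu_{N,L-1}$ converges weakly to $\hat\mu^{L-1}_{\varphi_c}$ as $N\to\infty$, where $\hat\mu_{N,L-1}$ and $\hat\mu^{L-1}_{\varphi_c}$ are the laws on $\mathbb N^{L-1}$ obtained from $\mu_{N,L}$ and $\bar\mu^{\{1,\dots,L\}}_{\varphi_c}$ respectively by ordering the coordinates of a configuration increasingly and removing the last (maximal) one.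
   Formalization: The limit law in the definition of condensation is the ordered sample of L−1 independent critical sites, not L critical sites with the maximum removed; with the latter the claim fails already for L=2, where the limit gives μ(0) but the minimum of two copies gives 2μ(0)−μ(0)². *)

(* Defs.v *)
From HB Require Import structures.
From mathcomp Require Import all_boot all_order all_algebra.
From mathcomp Require Import all_classical all_reals all_analysis measurable_realfun.

Set Implicit Arguments.
Unset Strict Implicit.
Unset Printing Implicit Defensive.

Import Order.TTheory GRing.Theory Num.Theory.
Import numFieldTopology.Exports numFieldNormedType.Exports.

Local Open Scope classical_set_scope.
Local Open Scope ring_scope.

(* Unconditional sum of a real family, meaningful when the family is
   absolutely summable. *)
Definition dsum (R : realType) (T : choiceType) (a : T -> R) : R :=
  fine (esum [set: T] (EFin \o a)^\+ - esum [set: T] (EFin \o a)^\-)%E.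

(* N^X with the product of the discrete topologies. *)
Notation conf X := {ptws X -> nat}.

(* N^X with its Borel sigma-algebra. *)
Definition bconf (X : countType) := g_sigma_algebraType (@open (conf X)).

Section dynamics.
Variables (R : realType) (X : countType).
Implicit Types (p : X -> X -> R) (g : nat -> nat -> R) (f : conf X -> R).
Implicit Types (eta zeta : conf X) (S : set (conf X)).

Definition transition_probability p :=
  (forall x y, 0 <= p x y) /\
  (forall x, (\esum_(y in [set: X]) (p x y)%:E)%E = 1%E).

Definition irreducible p :=
  forall x y, exists s : seq X,
    path (fun u v => 0 < p u v) x s /\ last x s = y.

(* k particles moved from x to y, used only for k <= eta x; for x = y this is
   eta itself. *)
Definition jump eta (x y : X) (k : nat) : conf X :=
  fun z => (eta z - (z == x) * k + (z == y) * k)%N.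

(* [g k a] is the rate g^k_a.  The sum over k stops at eta x because
   g^k_a = 0 for k > a. *)
Definition generator_term p g f eta (xy : X * X) : R :=
  p xy.1 xy.2 * \sum_(1 <= k < (eta xy.1).+1)
    g k (eta xy.1) * (f (jump eta xy.1 xy.2 k) - f eta).

Definition generator p g f eta : R := dsum (generator_term p g f eta).

Definition finite_conf eta := finite_set [set x | eta x <> 0%N].

Definition cylinder f := exists A : seq X,
  forall eta zeta, {in A, eta =1 zeta} -> f eta = f zeta.

Definition bounded_on S f := exists M : R, forall eta, S eta -> `|f eta| <= M.

Definition conf_le eta zeta := forall x, (eta x <= zeta x)%N.

Definition monotone_on S f :=
  forall eta zeta, S eta -> S zeta -> conf_le eta zeta -> f eta <= f zeta.

(* Expectation of f under the transition kernel: (S(t)f)(eta), for functions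
   f on the state space S.  Functions on S are represented by functions on
   N^X whose values outside S are irrelevant. *)
Definition semigroup S (P : R -> conf X -> probability (bconf X) R)
    (t : R) f : conf X -> R :=
  fun eta => Rintegral (P t eta) (S : set (bconf X)) f.

(* P is the transition function of a Markov process on S with jump rates
   p(x,y) g^k_{eta(x)}.  The last clause says that [generator] is its
   infinitesimal generator: on bounded cylinder functions at every
   configuration, and on all bounded measurable functions at configurations
   with finitely many particles, from which the process is an ordinary jump
   process with finite total rate. *)
Record mm_zrp p g S (P : R -> conf X -> probability (bconf X) R) : Prop := {
  mm_zrp_measurable : measurable (S : set (bconf X)) ;
  mm_zrp_finite : forall eta, finite_conf eta -> S eta ;
  mm_zrp_in : forall (t : R) eta, 0 <= t -> S eta -> P t eta S = 1%E ;
  mm_zrp_kernel : forall (t : R) (A : set (bconf X)), 0 <= t -> measurable A ->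
    measurable_fun (S : set (bconf X)) (P t ^~ A) ;
  mm_zrp_0 : forall eta (A : set (bconf X)), S eta -> measurable A ->
    P 0 eta A = \d_(eta : bconf X) A ;
  mm_zrp_markov : forall (s t : R) eta (A : set (bconf X)), 0 <= s -> 0 <= t ->
    S eta -> measurable A ->
    P (s + t) eta A = (\int[P s eta]_(zeta in (S : set (bconf X))) P t zeta A)%E ;
  mm_zrp_feller : forall (t : R) f, 0 <= t -> bounded_on S f ->
    {within S, continuous f} -> {within S, continuous (semigroup S P t f)} ;
  mm_zrp_generator : forall f eta, S eta -> bounded_on S f ->
    cylinder f \/
    (finite_conf eta /\ measurable_fun (S : set (bconf X)) (f : bconf X -> R)) ->
    summable [set: X * X] (EFin \o generator_term p g f eta) /\
    (fun t : R => (semigroup S P t f eta - f eta) / t) @ 0^'+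
      --> generator p g f eta
}.

Definition attractive S (P : R -> conf X -> probability (bconf X) R) :=
  forall f, bounded_on S f -> monotone_on S f -> {within S, continuous f} ->
  forall t : R, 0 < t ->
    [/\ bounded_on S (semigroup S P t f), monotone_on S (semigroup S P t f)
      & {within S, continuous (semigroup S P t f)}].

End dynamics.

Section condensation.
Variable R : realType.
Implicit Types (g : nat -> nat -> R) (w : nat -> R) (phi : R).

Definition partition_function w phi : \bar R :=
  (\sum_(n <oo) (phi ^+ n * w n)%:E)%E.

(* radius of convergence of phi |-> Z_phi (w is nonnegative) *)
Definition phi_c w : \bar R :=
  ereal_sup (EFin @` [set phi | 0 <= phi /\ (partition_function w phi < +oo)%E]).

Definition one_site_law w phi (n : nat) : R :=
  phi ^+ n * w n / fine (partition_function w phi).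

(* Laws on the countable sets N^L are given by their mass functions. *)
Definition product_law w phi (L : nat) (eta : {ffun 'I_L -> nat}) : R :=
  \prod_(i < L) one_site_law w phi (eta i).

Definition particles (L : nat) (eta : {ffun 'I_L -> nat}) : nat :=
  (\sum_(i < L) eta i)%N.

(* mu_{N,L}: [product_law] conditioned on having N particles *)
Definition canonical_law w phi (L N : nat) (eta : {ffun 'I_L -> nat}) : R :=
  if particles eta == N then
    product_law w phi eta /
    dsum (fun zeta : {ffun 'I_L -> nat} =>
            (particles zeta == N)%:R * product_law w phi zeta)
  else 0.

Definition stationary_law (L N : nat) (p : 'I_L -> 'I_L -> R) g
    (m : {ffun 'I_L -> nat} -> R) :=
  [/\ forall eta, 0 <= m eta,
      forall eta, particles eta <> N -> m eta = 0,
      dsum m = 1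
    & forall f : conf 'I_L -> R,
        dsum (fun eta : {ffun 'I_L -> nat} =>
                m eta * generator p g f (eta : 'I_L -> nat)) = 0].

Definition pushforward_law (T U : choiceType) (h : T -> U) (m : T -> R) : U -> R :=
  fun u => dsum (fun t => m t * (h t == u)%:R).

(* Weak convergence on a discrete space, where every function is continuous. *)
Definition weak_cvg (T : choiceType) (m : nat -> T -> R) (m' : T -> R) :=
  forall f : T -> R, (exists M : R, forall x, `|f x| <= M) ->
    (fun n => dsum (fun x => m n x * f x)) @ \oo --> dsum (fun x => m' x * f x).

Definition lowest (n L : nat) (eta : {ffun 'I_L -> nat}) : {ffun 'I_n -> nat} :=
  [ffun i : 'I_n => nth 0%N (sort leq (codom eta)) i].

(* The first clause records that mu_{N,L} is the unique stationary
   distribution of the process with rates g on a periodic box, whatever the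
   irreducible bistochastic p.  mu_{N,L} does not depend on phi, so every
   admissible phi is allowed in its definition.
   In the last clause the ordered configuration of mu_{N,L} without its
   maximal coordinate is compared with an ordered sample of the L - 1
   independent sites that remain, not with an ordered sample of L independent
   sites without its maximum: for L = 2 the latter would compare the limit,
   which is [one_site_law], with the minimum of two independent copies. *)
Definition condensation_fixed_volume g w :=
  [/\ forall (L N : nat) (p : 'I_L -> 'I_L -> R) phi
        (m : {ffun 'I_L -> nat} -> R),
        (2 <= L)%N -> transition_probability p -> irreducible p ->
        (forall y, \sum_(x < L) p x y = 1) ->
        0 < phi -> (partition_function w phi < +oo)%E ->
        stationary_law N p g m <-> m =1 canonical_law w phi N,
      (phi_c w < +oo)%E,
      (partition_function w (fine (phi_c w)) < +oo)%E
    & forall (L : nat) phi,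
        (2 <= L)%N -> 0 < phi -> (partition_function w phi < +oo)%E ->
        weak_cvg
          (fun N => pushforward_law (@lowest L.-1 L) (canonical_law w phi N))
          (pushforward_law (@lowest L.-1 L.-1)
             (product_law w (fine (phi_c w)) (L := L.-1)))].

End condensation.

Section rates.
Variables (R : realType) (b : R) (w : nat -> R).

Definition mm_rate (k a : nat) : R :=
  if (k == 0)%N || (a < k)%N then 0
  else if k == a then w 0%N
  else w 1%N * (\prod_(a - k <= i < a) (1 + b / i%:R)) /
             (\prod_(1 <= i < k) (1 + b / i%:R)).

Definition pi_b (n : nat) : R :=
  if n == 0%N then w 0%N else w 1%N / \prod_(1 <= i < n) (1 + b / i%:R).

End rates.

(* Main.v *)
Require Import Defs.
From mathcomp Require Import all_boot all_order all_algebra.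
From mathcomp Require Import all_classical all_reals all_analysis measurable_realfun.
From mathcomp Require Import ring lra zify.
Set Implicit Arguments.
Unset Strict Implicit.
Unset Printing Implicit Defensive.
Import Order.TTheory GRing.Theory Num.Theory.
Import numFieldTopology.Exports numFieldNormedType.Exports.
Local Open Scope classical_set_scope.
Local Open Scope ring_scope.

(** Attractiveness and condensation are two independent statements; both rest
on the form g^k_a = q(a-k) q(k) / q(a) of the rates, where q = pi_b satisfies
(n + b) q(n+1) = n q(n) for n >= 1 ([mm_rateE], [pi_bS]).

Attractiveness. Let G_a(l) be the total rate of the jumps of more than l
particles from a site with a particles. Take two configurations that differ by
one particle, sitting at z, with a and a + 1 particles there. Let k particles
jump from both at rate G_a(k-1) - G_{a+1}(k), and k particles from the smaller
one together with k + 1 from the larger one at rate G_{a+1}(k) - G_a(k). This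
has the right marginals, and after every jump the configurations again differ
by one particle. The rates of this coupling are nonnegative as soon as
G_{a+1}(l+1) <= G_a(l) <= G_{a+1}(l). The first inequality holds term by term
because n / (n + b) is increasing. In the second one the difference of the two
sides grows with l < a, so that only l = 0 matters; there G_a(0) is
q(0) + c_a / q(a), with c_a the sum of the q(k) q(a-k) over 0 < k < a. The
generating function of q solves a linear differential equation of the first
order, hence so does its square: this is the recursion [pi_b_conv_rec] for
c_a. For b = 3/2 its solution is explicit,
c_a / q(a) = (6 - 9/a + 6/(a(a+1))) q(1), and increases with a
([mm_rate_tail0_le]).

The coupled process itself is never built. For a measurable set A that is
increasing on finite configurations, u_t(eta) = P_t(eta, A) solves the backward
equation at every finite eta, and the coupling shows that the increments
u_t(eta + delta_z) - u_t(eta), for eta with a given number of particles, cannot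
have a slope below -C M while they are nonpositive and all of them are at least
-M ([generator_difference_ge]). The minimum principle
[family_minimum_principle] makes them nonnegative for all t. Integrating over
the level sets of a monotone f gives the monotonicity of S(t) f on finite
configurations, and the Feller property extends it to all configurations, since
each one is a limit of its truncations ([attractive_of_tails]).

Condensation. The product weights W satisfy
W(eta) g^k_{eta(x)} = q(k) W(eta - k delta_x), so that in the stationarity
equation the jumps of k particles to and from every configuration with k
particles less cancel ([weight_stationary]); irreducibility gives uniqueness
([stationary_vanishes]). For b = 3/2 one has
q(n) = (2n+1) q(n) - (2n+3) q(n+1) for n >= 1, hence the sum Z of the q(n) is
finite, while the terms of the series for phi > 1 are eventually nondecreasing:
phi_c = 1 ([phi_c_pi_b]). For the limit, split the configurations with N particles on L
sites according to the position of a largest coordinate. The L - 1 other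
coordinates xi have weight W(xi) q(N - |xi|), where N - |xi| >= N / L, so that
q(N - |xi|) / q(N) is bounded by a constant and tends to 1. By dominated
convergence the sum of W(eta) f(lowest eta), divided by q(N), tends to L times
the sum over N^{L-1} of W(xi) f(xi sorted) ([shell_sum_cvg]); dividing by the
same limit for f = 1 gives the claim. *)

(** * Unconditional sums *)

Section dsum_theory.
Variables (R : realType) (T : choiceType).
Implicit Types (a b c f g : T -> R) (s : seq T).

Definition asummable a := summable [set: T] (EFin \o a).

Lemma asummableE a :
  asummable a <-> (\esum_(x in [set: T]) `|a x|%:E < +oo)%E.
Proof. by []. Qed.

Lemma asummable_le a b : (forall x, `|a x| <= b x) -> asummable b -> asummable a.
Proof.
move=> ab; apply: le_lt_trans; apply: le_esum => x _ /=.
by rewrite lee_fin (le_trans (ab x))// ler_norm.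
Qed.

Lemma asummableD a b :
  asummable a -> asummable b -> asummable (fun x => a x + b x).
Proof. by move=> sa sb; apply: (summableD sa sb). Qed.

Lemma esum_bound (a : T -> R) (M : R) : (forall x, 0 <= a x) ->
  (forall s, uniq s -> \sum_(x <- s) a x <= M) ->
  (\esum_(x in [set: T]) (a x)%:E <= M%:E)%E.
Proof.
move=> a0 aM; apply: ge_ereal_sup => _ [X [finX _] <-].
by rewrite fsbig_finite//= sumEFin lee_fin; apply: aM.
Qed.

Lemma esum_ge_seq a s : uniq s -> (forall x, 0 <= a x) ->
  ((\sum_(x <- s) a x)%:E <= \esum_(x in [set: T]) (a x)%:E)%E.
Proof.
move=> us a0; apply: esum_ge; exists [set` s]; first by split.
rewrite -sumEFin; rewrite (fsbig_seq _ _ us)//.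
Qed.

Lemma asummable_bound a (M : R) :
  (forall s, uniq s -> \sum_(x <- s) `|a x| <= M) -> asummable a.
Proof.
move=> aM; apply: (@le_lt_trans _ _ M%:E); last exact: ltry.
exact: esum_bound.
Qed.

Lemma dsum_ge0E a : (forall x, 0 <= a x) ->
  dsum a = fine (\esum_(x in [set: T]) (a x)%:E).
Proof.
move=> a0; rewrite /dsum; congr fine.
rewrite [X in (_ - X)%E](_ : _ = 0%E) ?sube0; last first.
  rewrite esum1// => x _; rewrite (ge0_funenegE (D := setT)) ?inE// => y _.
  by rewrite lee_fin.
apply: eq_esum => x _; rewrite (ge0_funeposE (D := setT)) ?inE// => y _.
by rewrite lee_fin.
Qed.

Lemma dsum_esum a : (forall x, 0 <= a x) -> asummable a ->
  \esum_(x in [set: T]) (a x)%:E = (dsum a)%:E.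
Proof.
move=> a0 sa; rewrite dsum_ge0E// fineK// ge0_fin_numE; last first.
  by apply: esum_ge0 => x _; rewrite lee_fin.
apply: le_lt_trans sa; apply: le_esum => x _ /=.
by rewrite lee_fin ler_norm.
Qed.

Lemma dsum_ge0 a : (forall x, 0 <= a x) -> 0 <= dsum a.
Proof.
by move=> a0; rewrite dsum_ge0E// fine_ge0// esum_ge0// => x _; rewrite lee_fin.
Qed.

Lemma dsum_le_bound a (M : R) : (forall x, 0 <= a x) ->
  (forall s, uniq s -> \sum_(x <- s) a x <= M) -> dsum a <= M.
Proof.
move=> a0 aM; rewrite -lee_fin -dsum_esum//; first exact: esum_bound.
apply: (@asummable_bound _ M) => s us.
by under eq_bigr do rewrite ger0_norm//; apply: aM.
Qed.

Lemma ler_sum_dsum a s : uniq s -> (forall x, 0 <= a x) -> asummable a ->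
  \sum_(x <- s) a x <= dsum a.
Proof. by move=> us a0 sa; rewrite -lee_fin -dsum_esum//; apply: esum_ge_seq. Qed.

Lemma ge0_dsumB f g : (forall x, 0 <= f x) -> (forall x, 0 <= g x) ->
  asummable f -> asummable g -> dsum (fun x => f x - g x) = dsum f - dsum g.
Proof.
move=> f0 g0 sf sg; rewrite {1}/dsum.
have := esumB sf sg (fun x _ => f0 x) (fun x _ => g0 x).
rewrite (_ : ((EFin \o f) \- (EFin \o g))%E = EFin \o (fun x => f x - g x))//.
rewrite (_ : esum _ (fun i => (EFin \o f) i) = (dsum f)%:E); last exact: dsum_esum.
rewrite (_ : esum _ (fun i => (EFin \o g) i) = (dsum g)%:E); last exact: dsum_esum.
by move=> ->.
Qed.

Lemma ge0_dsumD f g : (forall x, 0 <= f x) -> (forall x, 0 <= g x) ->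
  asummable f -> asummable g -> dsum (fun x => f x + g x) = dsum f + dsum g.
Proof.
move=> f0 g0 sf sg; apply: EFin_inj; have sfg := asummableD sf sg.
have fg0 x : 0 <= f x + g x by rewrite addr_ge0.
rewrite EFinD -!dsum_esum//.
by rewrite -esumD// => x _; rewrite lee_fin.
Qed.

Let pos a := fun x => Num.max (a x) 0.
Let neg a := fun x => Num.max (- a x) 0.
Let pos_ge0 a x : 0 <= pos a x. Proof. by rewrite le_max lexx orbT. Qed.
Let neg_ge0 a x : 0 <= neg a x. Proof. by rewrite le_max lexx orbT. Qed.
Let posneg a x : a x = pos a x - neg a x.
Proof.
rewrite /pos /neg; have [?|?] := leP (a x) 0; have [?|?] := leP (- a x) 0; lra.
Qed.
Let spos a : asummable a -> asummable (pos a).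
Proof.
move=> sa; apply: (@asummable_le _ (fun x => `|a x|)).
  by move=> x; rewrite ger0_norm// ge_max ler_norm normr_ge0.
by apply/asummableE; under eq_esum do rewrite normr_id.
Qed.
Let sneg a : asummable a -> asummable (neg a).
Proof.
move=> sa; apply: (@asummable_le _ (fun x => `|a x|)).
  by move=> x; rewrite ger0_norm// ge_max -normrN ler_norm normr_ge0.
by apply/asummableE; under eq_esum do rewrite normr_id.
Qed.

Lemma asummable_norm a : asummable a -> asummable (fun x => `|a x|).
Proof. by move=> sa; apply/asummableE; under eq_esum do rewrite normr_id. Qed.

Lemma asummableN a : asummable a -> asummable (fun x => - a x).
Proof.
by move=> /asummable_norm; apply: asummable_le => x; rewrite normrN.
Qed.

Lemma asummableB a b :
  asummable a -> asummable b -> asummable (fun x => a x - b x).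
Proof. by move=> sa sb; apply: asummableD => //; apply: asummableN. Qed.

Lemma dsumB a b : asummable a -> asummable b ->
  dsum (fun x => a x - b x) = dsum a - dsum b.
Proof.
move=> sa sb.
have dE (c : T -> R) : asummable c -> dsum c = dsum (pos c) - dsum (neg c).
  move=> sc; rewrite -ge0_dsumB//; [|exact: spos|exact: sneg].
  by congr dsum; apply/funext => x; apply: posneg.
have -> : (fun x => a x - b x) =
    (fun x => (pos a x + neg b x) - (neg a x + pos b x)).
  by apply/funext => x; rewrite [a x]posneg [b x]posneg; ring.
rewrite ge0_dsumB; [|by move=> x; rewrite addr_ge0..| |].
- rewrite !ge0_dsumD//; do ?[exact: spos|exact: sneg].
  by rewrite (dE a sa) (dE b sb); ring.
- by apply: asummableD; [exact: spos|exact: sneg].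
- by apply: asummableD; [exact: sneg|exact: spos].
Qed.

Lemma dsum0 : dsum (fun _ : T => 0 : R) = 0.
Proof. by rewrite dsum_ge0E// esum1. Qed.

Lemma asummable0 : asummable (fun _ : T => 0 : R).
Proof. by apply/asummableE; rewrite esum1 ?ltry// => x _; rewrite normr0. Qed.

Lemma dsumN a : asummable a -> dsum (fun x => - a x) = - dsum a.
Proof.
move=> sa; rewrite -[RHS]sub0r -dsum0 -dsumB//; last exact: asummable0.
by congr dsum; apply/funext => x; rewrite sub0r.
Qed.

Lemma dsumD a b : asummable a -> asummable b ->
  dsum (fun x => a x + b x) = dsum a + dsum b.
Proof.
move=> sa sb; rewrite -[dsum b]opprK -dsumN// -dsumB//; last exact: asummableN.
by congr dsum; apply/funext => x; rewrite opprK.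
Qed.

Lemma ler_dsum a b : (forall x, a x <= b x) -> asummable a -> asummable b ->
  dsum a <= dsum b.
Proof.
move=> ab sa sb; rewrite -subr_ge0 -dsumB//; apply: dsum_ge0 => x.
by rewrite subr_ge0.
Qed.

Lemma ler_norm_dsum a : asummable a -> `|dsum a| <= dsum (fun x => `|a x|).
Proof.
move=> sa; have sn := asummable_norm sa.
rewrite ler_norml -dsumN//; apply/andP; split; apply: ler_dsum => //.
- by move=> x; rewrite lerNl -normrN ler_norm.
- exact: asummableN.
- by move=> x; rewrite ler_norm.
Qed.

Lemma asummableZ (k : R) a : asummable a -> asummable (fun x => k * a x).
Proof.
move=> /asummable_norm sa; apply: (@asummable_bound _ (`|k| * dsum (fun x => `|a x|))).
move=> s us; under eq_bigr do rewrite normrM.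
by rewrite -mulr_sumr ler_wpM2l// ler_sum_dsum.
Qed.

(** Partial sums give dsum (l c) <= l (dsum c) for l, c >= 0; the same bound
    for l^-1 gives the converse. *)
Lemma dsumZ (k : R) a : asummable a -> dsum (fun x => k * a x) = k * dsum a.
Proof.
have ge0Z (l : R) c : 0 <= l -> (forall x, 0 <= c x) -> asummable c ->
    dsum (fun x => l * c x) <= l * dsum c.
  move=> l0 c0 sc; apply: dsum_le_bound => [x|s us]; first by rewrite mulr_ge0.
  by rewrite -mulr_sumr ler_wpM2l// ler_sum_dsum.
have ge0ZE (l : R) c : 0 <= l -> (forall x, 0 <= c x) -> asummable c ->
    dsum (fun x => l * c x) = l * dsum c.
  rewrite le_eqVlt => /predU1P[<- c0 sc|l0 c0 sc].
    by rewrite mul0r -[RHS]dsum0; congr dsum; apply/funext => x; rewrite mul0r.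
  apply: le_anti; rewrite (ge0Z _ _ (ltW l0))//=.
  rewrite -ler_pdivlMl//.
  have -> : dsum c = dsum (fun x => l^-1 * (l * c x)).
    by congr dsum; apply/funext => x; rewrite mulKf// gt_eqF.
  apply: ge0Z; first by rewrite invr_ge0 ltW.
    by move=> x; rewrite mulr_ge0// ltW.
  exact: asummableZ.
have ge0ZEE (l : R) c : 0 <= l -> asummable c ->
    dsum (fun x => l * c x) = l * dsum c.
  move=> l0 sc; have -> : (fun x => l * c x) = fun x => l * pos c x - l * neg c x.
    by apply/funext => x; rewrite [c x]posneg mulrBr.
  rewrite dsumB; [|exact/asummableZ/spos|exact/asummableZ/sneg].
  rewrite !ge0ZE//; [|exact: sneg|exact: spos].
  rewrite -mulrBr -dsumB; [|exact: spos|exact: sneg].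
  by congr (_ * dsum _); apply/funext => x; rewrite [RHS]posneg.
move=> sa; have [k0|k0] := leP 0 k; first exact: ge0ZEE.
have -> : (fun x => k * a x) = (fun x => - (- k * a x)).
  by apply/funext => x; rewrite mulNr opprK.
rewrite dsumN; last exact: asummableZ.
by rewrite ge0ZEE// ?mulNr ?opprK// oppr_ge0 ltW.
Qed.

Lemma eq_dsum a b : a =1 b -> dsum a = dsum b.
Proof. by move=> /funext ->. Qed.

Lemma asummable_seq a s : (forall x, x \notin s -> a x = 0) -> asummable a.
Proof.
move=> as0; apply: (@asummable_bound _ (\sum_(x <- undup s) `|a x|)) => r ur.
rewrite (bigID (mem s))/= [X in _ + X]big1 ?addr0; last first.
  by move=> x /as0 ->; rewrite normr0.
rewrite -big_filter [leRHS](bigID (mem r))/= -[X in _ <= X + _]big_filter.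
rewrite [X in _ <= X + _](perm_big [seq x <- r | x \in s])/=; last first.
  apply: uniq_perm; rewrite ?filter_uniq ?undup_uniq// => x.
  by rewrite !mem_filter mem_undup/= andbC.
by rewrite lerDl sumr_ge0.
Qed.

Lemma dsum_seq a s : uniq s -> (forall x, x \notin s -> a x = 0) ->
  dsum a = \sum_(x <- s) a x.
Proof.
have ge0P c : uniq s -> (forall x, 0 <= c x) ->
    (forall x, x \notin s -> c x = 0) -> dsum c = \sum_(x <- s) c x.
  move=> us c0 cs0; apply/eqP; rewrite eq_le ler_sum_dsum ?andbT//; last first.
    exact: asummable_seq cs0.
  apply: dsum_le_bound => // r ur.
  rewrite (bigID (mem s))/= [X in _ + X]big1 ?addr0//.
  rewrite -big_filter [leRHS](bigID (mem r))/= -[X in _ <= X + _]big_filter.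
  rewrite [X in _ <= X + _](perm_big [seq x <- r | x \in s])/=; last first.
    apply: uniq_perm; rewrite ?filter_uniq// => x.
    by rewrite !mem_filter/= andbC.
  by rewrite lerDl sumr_ge0.
move=> us as0; have sa := asummable_seq as0.
have -> : a = (fun x => pos a x - neg a x) by apply/funext => x; apply: posneg.
rewrite dsumB; [|exact: spos|exact: sneg].
rewrite !ge0P ?sumrB// => x /as0 ax; rewrite /pos /neg ax ?oppr0 maxxx//.
Qed.

End dsum_theory.

Lemma dsum_fin (R : realType) (T : finType) (a : T -> R) :
  dsum a = \sum_x a x.
Proof.
rewrite (@dsum_seq _ _ a (index_enum T)) ?index_enum_uniq// => x.
by rewrite mem_index_enum.
Qed.

Lemma asummable_fin (R : realType) (T : finType) (a : T -> R) : asummable a.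
Proof. by apply: (@asummable_seq _ _ a (index_enum T)) => x; rewrite mem_index_enum. Qed.

Section dsum_limits.
Variables (R : realType) (T : choiceType).
Implicit Types (a g : T -> R) (s : seq T).

Lemma dsum_split a s : uniq s -> asummable a ->
  dsum a = \sum_(x <- s) a x + dsum (fun x => if x \in s then 0 else a x).
Proof.
move=> us sa.
have out x : x \notin s -> (if x \in s then a x else 0) = 0 by move/negPf->.
have sin := asummable_seq out.
have sout : asummable (fun x => if x \in s then 0 else a x).
  apply: asummable_le (asummable_norm sa) => x.
  by case: ifP; rewrite ?normr0.
have -> : \sum_(x <- s) a x = dsum (fun x => if x \in s then a x else 0).
  by rewrite (dsum_seq us out) big_seq [RHS]big_seq; apply: eq_bigr => x ->.
rewrite -dsumD//; apply: eq_dsum => x.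
by case: ifP; rewrite ?addr0 ?add0r.
Qed.

Lemma dsum_tail g (e : R) : (forall x, 0 <= g x) -> asummable g -> 0 < e ->
  exists2 s, uniq s & dsum (fun x => if x \in s then 0 else g x) < e.
Proof.
move=> g0 sg e0.
have : ((dsum g - e)%:E < \esum_(x in [set: T]) (g x)%:E)%E.
  by rewrite dsum_esum// lte_fin; lra.
move=> /ereal_sup_gt[_ [X [finX _] <-]].
rewrite fsbig_finite//= sumEFin lte_fin => lt_sum.
have us := finmap.fset_uniq (fset_set X).
by exists (finmap.enum_fset (fset_set X)) => //; have := dsum_split us sg; lra.
Qed.

(** All but a small part of dsum g is carried by a finite set: off this set
    every term is controlled by g, and on it the sums are finite. *)
Lemma dsum_dominated_cvg (a_ : nat -> T -> R) a g : asummable g ->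
  (forall n x, `|a_ n x| <= g x) ->
  (forall x, (fun n => a_ n x) @ \oo --> a x) ->
  (fun n => dsum (a_ n)) @ \oo --> dsum a.
Proof.
move=> sg ag cva.
have g0 x : 0 <= g x by apply: le_trans (ag 0%N x).
have ag' x : `|a x| <= g x.
  have /cvg_norm cvn := cva x.
  rewrite -(cvg_lim (@Rhausdorff R) cvn).
  apply: limr_le; first by apply/cvg_ex; eexists; exact: cvn.
  by apply: nearW => n; exact: ag.
have san n := asummable_le (ag n) sg.
have sa := asummable_le ag' sg.
apply/cvgrPdist_lt => e e0.
have e4 : 0 < e / 4 by lra.
have [s us tail] := dsum_tail g0 sg e4.
have cvs : (fun n => \sum_(x <- s) `|a x - a_ n x|) @ \oo --> (0 : R).
  rewrite -[X in _ --> X](_ : \sum_(x <- s) (0 : R) = 0); last by rewrite big1.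
  apply: cvg_big => [|x _]; first exact: add_continuous.
  rewrite -[X in _ --> X](normr0 R); apply: cvg_norm.
  by rewrite -[X in _ --> X](subrr (a x)); apply: cvgB => //; exact: cvg_cst.
have e2 : 0 < e / 2 by lra.
move/cvgrPdist_lt : cvs => /(_ _ e2)[N _ hN].
exists N => //= n /hN /=.
rewrite sub0r normrN ger0_norm ?sumr_ge0// => lts.
have sb := asummableB sa (san n).
rewrite -dsumB//; apply: (le_lt_trans (ler_norm_dsum sb)).
rewrite (dsum_split us (asummable_norm sb)).
have sgt : asummable (fun x => if x \in s then 0 else g x).
  by apply: asummable_le sg => x; case: ifP; rewrite ?normr0// ger0_norm.
suff : dsum (fun x => if x \in s then 0 else `|a x - a_ n x|) <=
    2 * dsum (fun x => if x \in s then 0 else g x) by lra.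
rewrite -dsumZ//; apply: ler_dsum.
- move=> x; case: ifP => _; first by rewrite mulr0.
  by apply: (le_trans (ler_normB _ _)); have := ag' x; have := ag n x; lra.
- apply: asummable_le (asummable_norm sb) => x.
  by case: ifP; rewrite ?normr0 ?normr_id.
- exact: asummableZ.
Qed.

End dsum_limits.

Section pushforward.
Variables (R : realType) (T U : choiceType) (h : T -> U) (m : T -> R).
Hypotheses (m0 : forall t, 0 <= m t) (sm : asummable m).

Let smf (f : U -> R) (M : R) : (forall u, `|f u| <= M) ->
  asummable (fun t => m t * f (h t)).
Proof.
move=> fM; have : asummable (fun t => M * m t) by exact: asummableZ.
apply: asummable_le => t.
by rewrite normrM mulrC [`|m t|]ger0_norm// ler_wpM2r.
Qed.

Lemma pushforward_law_ge0 u : 0 <= pushforward_law h m u.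
Proof. by apply: dsum_ge0 => t; rewrite mulr_ge0. Qed.

Let smu u : asummable (fun t => m t * (h t == u)%:R).
Proof.
apply: (smf (f := fun v => (v == u)%:R) (M := 1)) => v.
by case: (v == u); rewrite ?normr0 ?normr1.
Qed.

Let esum_pushforward (f : U -> R) : (forall u, 0 <= f u) ->
  (\esum_(u in [set: U]) (pushforward_law h m u * f u)%:E =
   \esum_(t in [set: T]) (m t * f (h t))%:E)%E.
Proof.
move=> f0.
have ge0 t u : (0 <= (f u * (m t * (h t == u)%:R))%:E)%E.
  by rewrite lee_fin !mulr_ge0.
transitivity (\esum_(u in [set: U]) \esum_(t in [set: T])
   (f u * (m t * (h t == u)%:R))%:E)%E.
  apply: eq_esum => u _; rewrite dsum_esum//.
  - by rewrite dsumZ// mulrC.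
  - by move=> t; rewrite !mulr_ge0.
  - exact/asummableZ/smu.
transitivity (\esum_(t in [set: T]) \esum_(u in [set: U])
   (f u * (m t * (h t == u)%:R))%:E)%E; last first.
  apply: eq_esum => t _.
  rewrite (esumID [set h t])// setTI [X in (_ + X)%E]esum1 ?adde0.
    by rewrite esum_set1// eqxx mulr1 mulrC.
  by move=> u [_ /= /eqP]; rewrite eq_sym => /negPf ->; rewrite !mulr0.
rewrite !esum_esum//.
rewrite (reindex_esum ([set: T] `*`` (fun=> [set: U])) _ (fun x => (x.2, x.1)))//.
split=> //=; first by move=> [i1 j1] [i2 j2] /= _ _ [] -> ->.
by move=> [i1 i2] _ /=; exists (i2, i1).
Qed.

Let spf (f : U -> R) (M : R) : (forall u, `|f u| <= M) ->
  asummable (fun u => pushforward_law h m u * f u).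
Proof.
move=> fM; apply/asummableE.
rewrite (_ : (fun u => _) = fun u => (pushforward_law h m u * `|f u|)%:E).
  rewrite esum_pushforward//.
  have s := @smf (fun u => `|f u|) M; rewrite dsum_esum ?ltry//.
    by move=> t; rewrite mulr_ge0.
  by apply: s => u; rewrite normr_id.
by apply/funext => u; rewrite normrM ger0_norm// pushforward_law_ge0.
Qed.

(** Change of variables. For f >= 0 it is the exchange of two sums of
    nonnegative terms; a bounded f becomes nonnegative after adding M. *)
Lemma dsum_pushforward (f : U -> R) (M : R) : (forall u, `|f u| <= M) ->
  dsum (fun u => pushforward_law h m u * f u) = dsum (fun t => m t * f (h t)).
Proof.
move=> fM.
have M0 u : 0 <= M := le_trans (normr_ge0 (f u)) (fM u).
have ge0E (k : U -> R) (K : R) : (forall u, 0 <= k u) -> (forall u, `|k u| <= K) ->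
   dsum (fun u => pushforward_law h m u * k u) = dsum (fun t => m t * k (h t)).
  move=> k0 kK; apply: EFin_inj; rewrite -!dsum_esum//.
  - exact: esum_pushforward.
  - by move=> t; rewrite mulr_ge0.
  - exact: smf kK.
  - by move=> t; rewrite mulr_ge0// pushforward_law_ge0.
  - exact: spf kK.
have fM0 u : 0 <= f u + M.
  by move: (fM u); rewrite ler_norml => /andP[+ _]; rewrite -subr_ge0 opprK.
have fMM u : `|f u + M| <= 2 * M.
  by rewrite ger0_norm// mulr_natl mulr2n lerD2r (le_trans (ler_norm _)).
have cM (u : U) : `|M| <= M by rewrite ger0_norm// (M0 u).
have := ge0E _ _ fM0 fMM.
have := ge0E _ _ M0 cM => EM.
have -> : (fun u => pushforward_law h m u * (f u + M)) =
   (fun u => pushforward_law h m u * f u + pushforward_law h m u * M).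
  by apply/funext => u; rewrite mulrDr.
have -> : (fun t => m t * (f (h t) + M)) = (fun t => m t * f (h t) + m t * M).
  by apply/funext => u; rewrite mulrDr.
rewrite dsumD; [|exact: spf fM|exact: spf cM].
rewrite dsumD; [|exact: smf fM|exact: smf cM].
by rewrite EM => /addIr.
Qed.

End pushforward.

(** * The weights pi_b and the tails of the jump rates *)

(** Rate at which more than l particles leave together a site that contains a
    of them. *)
Definition rate_tail (R : realType) (g : nat -> nat -> R) (a l : nat) : R :=
  \sum_(l.+1 <= k < a.+1) g k a.

Section weights.
Variables (R : realType) (b : R) (w : nat -> R).
Hypotheses (b_gt0 : 0 < b) (w_gt0 : forall n, 0 < w n).
Let q := pi_b b w.
Let g := mm_rate b w.

Let pr n := \prod_(1 <= i < n) (1 + b / i%:R).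

Let pr_gt0 n : 0 < pr n.
Proof.
by apply: prodr_gt0 => i _; rewrite ltr_pwDl// divr_ge0// ltW.
Qed.

Lemma pi_b_gt0 n : 0 < q n.
Proof. by rewrite /q /pi_b; case: eqP => _ //; rewrite divr_gt0// pr_gt0. Qed.

Lemma pi_bS n : (n.+1%:R + b) * q n.+2 = n.+1%:R * q n.+1.
Proof.
rewrite /q /pi_b /= [in LHS]big_nat_recr//= -/(pr n.+1).
have := pr_gt0 n.+1; have : 0 < n.+1%:R :> R by rewrite ltr0n.
move: (pr n.+1) (n.+1%:R : R) => p m m0 p0; field.
by rewrite !gt_eqF// addr_gt0.
Qed.

Lemma mm_rateE k a : (1 <= k <= a)%N -> g k a = q (a - k)%N * q k / q a.
Proof.
move=> /andP[k1 ka]; rewrite /g /mm_rate ltnNge ka orbF.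
rewrite (negPf (lt0n_neq0 k1)).
have [->|kna] := eqVneq k a.
  by rewrite subnn /q {1}/pi_b/= mulfK// gt_eqF// pi_b_gt0.
have lka : (k < a)%N by rewrite ltn_neqAle kna.
have ak : (0 < a - k)%N by rewrite subn_gt0.
rewrite /q /pi_b (negPf (lt0n_neq0 k1)) (negPf (lt0n_neq0 ak)).
rewrite (negPf (lt0n_neq0 (leq_trans k1 ka))).
rewrite (big_cat_nat (n := a - k) _ (m := 1) (p := a))//= ?leq_subr//.
rewrite -!/(pr _); have := w_gt0 1; have := pr_gt0 k; have := pr_gt0 (a - k).
have : 0 < \prod_(a - k <= i < a) (1 + b / i%:R).
  by apply: prodr_gt0 => i _; rewrite ltr_pwDl// divr_ge0// ltW.
move: (pr k) (pr _) (\prod_(_ <= _ < _) _) (w 1) => x y z u *; field.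
by rewrite !gt_eqF.
Qed.

Lemma mm_rate_ge0 k a : 0 <= g k a.
Proof.
have [h|] := boolP (1 <= k <= a)%N.
  by rewrite mm_rateE// divr_ge0// ?mulr_ge0// ltW// pi_b_gt0.
by rewrite negb_and -leqNgt leqn0 -ltnNge /g /mm_rate => ->.
Qed.

(** q (n+1) / q n = n / (n + b) increases with n >= 1. *)
Lemma pi_b_ratio k a : (1 <= k <= a)%N -> q k.+1 * q a <= q k * q a.+1.
Proof.
case: k a => // k [|a] //=; rewrite ltnS => ka.
have ka' : k.+1%:R <= a.+1%:R :> R by rewrite ler_nat.
have k0 : 0 < k.+1%:R :> R by rewrite ltr0n.
have a0 : 0 < a.+1%:R :> R by rewrite ltr0n.
have qk := pi_bS k; have qa := pi_bS a.
have q1 := pi_b_gt0 k.+1; have q2 := pi_b_gt0 a.+1.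
have -> : q k.+2 = k.+1%:R * q k.+1 / (k.+1%:R + b).
  by rewrite -qk mulrC mulKf// gt_eqF// addr_gt0.
have -> : q a.+2 = a.+1%:R * q a.+1 / (a.+1%:R + b).
  by rewrite -qa mulrC mulKf// gt_eqF// addr_gt0.
move: (k.+1%:R) (a.+1%:R) (q k.+1) (q a.+1) ka' k0 a0 q1 q2.
clear -b_gt0 => k' a' qk qa ka' k0 a0 q1 q2.
have kb : 0 < k' + b by rewrite addr_gt0.
have ab : 0 < a' + b by rewrite addr_gt0.
rewrite -subr_ge0.
have -> : qk * (a' * qa / (a' + b)) - k' * qk / (k' + b) * qa =
   qk * qa * b * (a' - k') / ((k' + b) * (a' + b)).
  by field; rewrite !gt_eqF.
by rewrite divr_ge0 ?mulr_ge0// ?subr_ge0// ltW.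
Qed.

(** As many particles stay behind on both sides, so that only the ratios
    q (k+1) / q k and q (a+1) / q a are compared. *)
Lemma mm_rateS_le k a : (1 <= k <= a)%N -> g k.+1 a.+1 <= g k a.
Proof.
move=> h; rewrite !mm_rateE//; last by case/andP: h => ? ?; apply/andP; split.
rewrite subSS ler_pdivrMr ?pi_b_gt0// mulrAC ler_pdivlMr ?pi_b_gt0//.
rewrite -(mulrA _ (q k.+1)) -(mulrA _ (q k)) ler_wpM2l ?(ltW (pi_b_gt0 _))//.
exact: pi_b_ratio.
Qed.

(** As many particles jump on both sides, so that the ratios compared are
    q (a-k+1) / q (a-k) and q (a+1) / q a, with a - k >= 1 in [pi_b_ratio]. *)
Lemma mm_rate_le k a : (1 <= k < a)%N -> g k a.+1 <= g k a.
Proof.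
move=> /andP[k1 ka]; rewrite !mm_rateE ?k1 ?leqW ?(ltnW ka)//.
rewrite ler_pdivrMr ?pi_b_gt0// mulrAC ler_pdivlMr ?pi_b_gt0//.
rewrite mulrAC [leRHS]mulrAC ler_wpM2r ?(ltW (pi_b_gt0 _))// subSn ?(ltnW ka)//.
by apply: pi_b_ratio; rewrite subn_gt0 ka leq_subr.
Qed.

Lemma mm_rate_tailS_le a l : rate_tail g a.+1 l.+1 <= rate_tail g a l.
Proof.
rewrite /rate_tail [leLHS]big_add1/= big_nat [leRHS]big_nat; apply: ler_sum => k.
by move=> /andP[h1 h2]; apply: mm_rateS_le; rewrite (leq_trans _ h1).
Qed.

Let c n := \sum_(1 <= k < n) q k * q (n - k)%N.

(** Under the symmetry k <-> n - k the factor on the left becomes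
    2 (k + b - 1), and (k + b - 1) q k = (k - 1) q (k - 1) for k > 1. This is
    the differential equation of the square of the generating function of q,
    read on coefficients. *)
Lemma pi_b_conv_rec n : (n.+1%:R + 2 * b - 1) * c n.+2 =
  n.+1%:R * c n.+1 + 2 * b * q 1 * q n.+1.
Proof.
have := pi_bS; rewrite /c; generalize q => p pS; clear - pS.
have sym (f : nat -> nat -> R) m :
    \sum_(1 <= k < m.+1) f k (m.+1 - k)%N = \sum_(1 <= k < m.+1) f (m.+1 - k)%N k.
  rewrite big_nat_rev/= add1n big_nat [RHS]big_nat; apply: eq_bigr => k.
  by move=> /andP[k1 km]; rewrite subSS subKn// ltnW.
have E2 : (n.+1%:R + 2 * b - 1) * (\sum_(1 <= k < n.+2) p k * p (n.+2 - k)%N) =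
   2 * \sum_(1 <= k < n.+2) (k%:R + b - 1) * (p k * p (n.+2 - k)%N).
  rewrite [RHS]mulr_natl [RHS]mulr2n {2}(sym (fun k j => (k%:R + b - 1) * (p k * p j))).
  rewrite -big_split/= mulr_sumr [LHS]big_nat [RHS]big_nat; apply: eq_bigr => k.
  move=> /andP[k1 kn]; rewrite natrB ?(ltnW kn)//.
  by rewrite -[n.+2%:R]natr1; ring.
have E1 : n.+1%:R * (\sum_(1 <= k < n.+1) p k * p (n.+1 - k)%N) =
   2 * \sum_(1 <= k < n.+1) k%:R * (p k * p (n.+1 - k)%N).
  rewrite [RHS]mulr_natl [RHS]mulr2n {2}(sym (fun k j => k%:R * (p k * p j))).
  rewrite -big_split/= mulr_sumr [LHS]big_nat [RHS]big_nat; apply: eq_bigr => k.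
  by move=> /andP[k1 kn]; rewrite natrB ?(ltnW kn)//; ring.
rewrite E2 E1 big_ltn// big_add1/= mulrDr addrC; congr (_ + _); last first.
  by rewrite subn1/=; ring.
congr (_ * _); rewrite big_nat [RHS]big_nat; apply: eq_bigr => -[//|k] _.
rewrite !mulrA -pS subSS; congr (_ * _ * _).
by rewrite -[k.+2%:R]natr1; ring.
Qed.

End weights.

Section three_halves.
Variables (R : realType) (w : nat -> R).
Hypothesis (w_gt0 : forall n, 0 < w n).
Let b : R := 3 / 2.
Let b_gt0 : 0 < b. Proof. by rewrite /b; lra. Qed.
Let q := pi_b b w.
Let g := mm_rate b w.
Let q_gt0 n : 0 < q n. Proof. exact: pi_b_gt0. Qed.

(** For b = 3/2 the recursion [pi_b_conv_rec] has this rational solution: the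
    induction step is a polynomial identity in n. *)
Lemma pi_b_conv_closed n :
  \sum_(1 <= k < n.+1) q k * q (n.+1 - k)%N * (n.+1%:R * n.+2%:R) =
  3 * (2 * n.+1%:R + 1) * n%:R * q 1 * q n.+1.
Proof.
elim: n => [|n IHn]; first by rewrite big_geq// mulr0 !mul0r.
have := pi_b_conv_rec w b_gt0 n; rewrite -/q.
rewrite -!mulr_suml in IHn *; move: IHn.
move: (\sum_(_ <= _ < _) _) => c1; move: (\sum_(_ <= _ < _) _) => c2 IHn rec.
have qS := pi_bS w b_gt0 n; rewrite -/q in qS.
have -> : n.+3%:R = n%:R + 3 :> R by rewrite -natrD addn3.
have E2 : n.+2%:R = n%:R + 2 :> R by rewrite -natrD addn2.
have E1 : n.+1%:R = n%:R + 1 :> R by rewrite natr1.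
rewrite E2 E1 in IHn rec qS *; rewrite /b in rec qS.
have -> : c2 * ((n%:R + 2) * (n%:R + 3)) =
   (n%:R + 2) * ((n%:R + 1 + 2 * (3 / 2) - 1) * c2) by field.
rewrite rec mulrDr.
have -> : (n%:R + 2) * ((n%:R + 1) * c1) = c1 * ((n%:R + 1) * (n%:R + 2)) by ring.
rewrite IHn.
have -> : 3 * (2 * (n%:R + 2) + 1) * (n%:R + 1) * q 1 * q n.+2 =
  6 * (n%:R + 1) * q 1 * ((n%:R + 1 + 3 / 2) * q n.+2) by field.
by rewrite qS; field.
Qed.

Lemma mm_rate_tail0E a : rate_tail (mm_rate b w) a.+1 0 =
  w 0 + 3 * (2 * a.+1%:R + 1) * a%:R / (a.+1%:R * a.+2%:R) * w 1.
Proof.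
rewrite /rate_tail big_nat_recr//= addrC; congr (_ + _).
  by rewrite mm_rateE ?leqnn// subnn -/q (mulfK (lt0r_neq0 (q_gt0 _))).
have q1 : q 1 = w 1 by rewrite /q /pi_b/= big_geq// divr1.
have qa : q a.+1 != 0 by rewrite gt_eqF.
have a12 : a.+1%:R * a.+2%:R != 0 :> R by rewrite mulf_neq0// pnatr_eq0.
have := pi_b_conv_closed a; rewrite q1 -mulr_suml => /(canRL (mulfK a12)) E.
apply: (mulIf qa).
transitivity (\sum_(1 <= k < a.+1) q k * q (a.+1 - k)%N).
  rewrite mulr_suml big_nat [RHS]big_nat; apply: eq_bigr => k /andP[k1 ka].
  by rewrite mm_rateE ?k1 ?(ltnW ka)// -/q mulfVK// mulrC.
by rewrite E; field; rewrite nat1r -natrD !pnatr_eq0.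
Qed.

Lemma mm_rate_tail0_le a :
  rate_tail (mm_rate b w) a 0 <= rate_tail (mm_rate b w) a.+1 0.
Proof.
case: a => [|a].
  by rewrite {1}/rate_tail big_geq// sumr_ge0// => k _; apply: mm_rate_ge0.
rewrite !mm_rate_tail0E lerD2l ler_wpM2r ?(ltW (w_gt0 1))//.
rewrite -[a.+3%:R]natr1 -[a.+2%:R]natr1 -[a.+1%:R]natr1.
have : 0 <= a%:R :> R by rewrite ler0n.
move: (a%:R : R) => x x0; rewrite -subr_ge0.
have -> : 3 * (2 * (x + 1 + 1) + 1) * (x + 1) / ((x + 1 + 1) * (x + 1 + 1 + 1)) -
   3 * (2 * (x + 1) + 1) * x / ((x + 1) * (x + 1 + 1)) =
   3 * (3 * x + 5) / ((x + 1) * (x + 1 + 1) * (x + 1 + 1 + 1)).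
  by field; rewrite !gt_eqF//; lra.
by rewrite divr_ge0 ?mulr_ge0//; lra.
Qed.

(** For k < a the rates g k a decrease with a, so that for l < a the difference
    of the two sides is smallest at l = 0. *)
Lemma mm_rate_tail_le a l :
  rate_tail (mm_rate b w) a l <= rate_tail (mm_rate b w) a.+1 l.
Proof.
have ge0 k a' : 0 <= mm_rate b w k a' by exact: mm_rate_ge0.
have [al|la] := leqP a l.
  by rewrite {1}/rate_tail big_geq ?ltnS// sumr_ge0.
have split0 a' : (l < a'.+1)%N -> rate_tail (mm_rate b w) a' 0 =
    \sum_(1 <= k < l.+1) mm_rate b w k a' + rate_tail (mm_rate b w) a' l.
  by move=> h; rewrite /rate_tail -big_cat_nat.
have := mm_rate_tail0_le a; rewrite !split0 ?(ltnW la) ?leqW ?(ltnW la)//.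
have : \sum_(1 <= k < l.+1) mm_rate b w k a.+1 <=
       \sum_(1 <= k < l.+1) mm_rate b w k a.
  rewrite big_nat [leRHS]big_nat; apply: ler_sum => k /andP[k1 kl].
  by apply: mm_rate_le => //; rewrite k1 (leq_trans kl).
by move: (\sum_(_ <= _ < _) _) (\sum_(_ <= _ < _) _) => x y; lra.
Qed.

End three_halves.

(** * A minimum principle for right derivatives *)

Section minimum_principle.
Variable R : realType.

(** Continuity induction along the line of slope -(K + e): at the last time up
    to which phi is above it, either phi is positive and stays so for a while by
    continuity, or the right slope is larger than that of the line. *)
Lemma slope_lower_bound (phi : R -> R) (K T : R) :
  0 <= T -> 0 <= K -> 0 <= phi 0 ->
  (forall e, 0 < e -> exists2 d, 0 < d &
     forall t h, 0 <= t -> 0 <= h < d -> `|phi (t + h) - phi t| <= e) ->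
  (forall t, 0 <= t < T -> phi t <= 0 ->
     forall e, 0 < e -> exists2 d, 0 < d &
     forall h, 0 < h < d -> phi t - (K + e) * h <= phi (t + h)) ->
  forall t, 0 <= t <= T -> - (K * t) <= phi t.
Proof.
move=> T0 K0 phi0 cont slope.
(* the slack e makes the slope comparison strict; it is removed at the end *)
suff main (e : R) : 0 < e -> forall t, 0 <= t <= T -> 0 <= phi t + (K + e) * t.
  move=> t /andP[t0 tT]; apply/ler_addgt0Pl => e e0.
  have T1 : 0 < T + 1 by lra.
  have eT : 0 < e / (T + 1) by rewrite divr_gt0.
  have /(_ t) := main _ eT; rewrite t0 tT => /(_ isT).
  have : e / (T + 1) * t <= e.
    by rewrite mulrAC ler_pdivrMr// ler_pM2l//; lra.
  by rewrite mulrDl; lra.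
move=> e0; set psi := fun s => phi s + (K + e) * s.
have Ke : 0 < K + e by lra.
pose A := [set t | 0 <= t <= T /\ forall s, 0 <= s <= t -> 0 <= psi s].
have A0 : A 0.
  split; first by rewrite lexx.
  move=> s ss; have -> : s = 0 by apply: le_anti; rewrite andbC.
  by rewrite /psi mulr0 addr0.
have supA : has_sup A.
  by split; [exists 0|exists T => t [/andP[]]].
pose tau := sup A.
have tau0 : 0 <= tau by apply: sup_upper_bound.
have tauT : tau <= T by apply: ge_sup; [exists 0|move=> t [/andP[]]].
have below s : 0 <= s < tau -> 0 <= psi s.
  move=> /andP[s0 st].
  have ts0 : 0 < tau - s by rewrite subr_gt0.
  have [t [_ At] lt_st] := sup_adherent ts0 supA.
  by apply: At; rewrite s0/= ltW//; move: lt_st; rewrite -/tau opprB addrC subrK.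
have psitau : 0 <= psi tau.
  move: tau0; rewrite le_eqVlt => /predU1P[<-|tau_gt0].
    by rewrite /psi mulr0 addr0.
  apply/ler_addgt0Pl => d d0.
  have d2 : 0 < d / 2 by lra.
  have [d1 d10 hd1] := cont _ d2.
  pose h := Num.min (d1 / 2) tau.
  have h0 : 0 < h by rewrite !lt_min tau_gt0 !divr_gt0.
  have htau : h <= tau by rewrite /h !ge_min lexx orbT.
  have hd : h < d1.
    by apply: (@le_lt_trans _ _ (d1 / 2)); [rewrite /h ge_min lexx|lra].
  have hK : 0 <= (K + e) * h by rewrite mulr_ge0// ltW.
  have := hd1 (tau - h) h; rewrite subrK subr_ge0 htau hd ltW//= => /(_ isT isT).
  rewrite ler_norml => /andP[Hl _].
  have /below : 0 <= tau - h < tau by rewrite subr_ge0 htau/= gtrBl.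
  by rewrite /psi mulrBr; lra.
have step : tau < T ->
    exists2 d, 0 < d & forall h, 0 < h < d -> 0 <= psi (tau + h).
  move=> ltT; have [phi_le|phi_gt] := leP (phi tau) 0.
    have /(_ _ phi_le _ e0)[|d d0 hd] := slope tau; first by rewrite tau0.
    exists d => // h /hd; move: psitau; rewrite /psi mulrDr; lra.
  have [d d0 hd] := cont _ phi_gt.
  exists d => // h /andP[h0 hd'].
  have := hd tau h tau0; rewrite hd' ltW// => /(_ isT).
  rewrite ler_norml => /andP[+ _].
  have : 0 <= (K + e) * (tau + h) by rewrite mulr_ge0 ?addr_ge0// ltW.
  by rewrite /psi; lra.
have upto s : 0 <= s <= tau -> 0 <= psi s.
  move=> /andP[s0]; rewrite le_eqVlt => /predU1P[->//|st].
  by apply: below; rewrite s0.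
suff -> : T = tau by exact: upto.
apply/eqP; rewrite eq_le tauT andbT leNgt; apply/negP => ltT.
have [d d0 hd] := step ltT.
pose h := Num.min (d / 2) (T - tau).
have h0 : 0 < h.
  by rewrite lt_min divr_gt0//= subr_gt0.
have hd2 : h < d by apply: (@le_lt_trans _ _ (d / 2)); [rewrite /h ge_min lexx|lra].
have hT : tau + h <= T by rewrite -lerBrDl /h ge_min lexx orbT.
suff : A (tau + h) by move/(sup_upper_bound supA); rewrite -/tau; lra.
split=> [|s /andP[s0 sh]]; first by rewrite addr_ge0//= ltW.
have [st|ts] := leP s tau; first by apply: upto; rewrite s0.
by rewrite -(subrK tau s) addrC; apply: hd; lra.
Qed.

(** Over a time 1 / (2 C) a lower bound -M for the family improves to -M / 2 by
    [slope_lower_bound]; iterating it on the same time window gives 0, and the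
    windows cover the half-line. *)
Lemma family_minimum_principle (I : Type) (F : R -> I -> R) (C : R) :
  0 < C ->
  (forall t i, 0 <= t -> -1 <= F t i) ->
  (forall i, 0 <= F 0 i) ->
  (forall i e, 0 < e -> exists2 d, 0 < d &
     forall t h, 0 <= t -> 0 <= h < d -> `|F (t + h) i - F t i| <= e) ->
  (forall t M i, 0 <= t -> 0 <= M -> (forall j, - M <= F t j) -> F t i <= 0 ->
     forall e, 0 < e -> exists2 d, 0 < d &
     forall h, 0 < h < d -> F t i - (C * M + e) * h <= F (t + h) i) ->
  forall t i, 0 <= t -> 0 <= F t i.
Proof.
move=> C0 F1 F0 cont slope.
(* the length of the window is chosen so that C * T = 1 / 2 *)
pose T := (2 * C)^-1.
have T0 : 0 < T by rewrite invr_gt0; lra.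
have CT : C * T = 1 / 2 by rewrite /T; field; rewrite gt_eqF.
have window t0 : 0 <= t0 -> (forall i, 0 <= F t0 i) ->
    forall t i, 0 <= t <= T -> 0 <= F (t0 + t) i.
  move=> t00 Ft0.
  have geom n : forall t i, 0 <= t <= T -> - (2^-1 ^+ n) <= F (t0 + t) i.
    elim: n => [|n IHn] t i /andP[t1 tT].
      by rewrite expr0 F1// addr_ge0.
    have M0 : 0 <= 2^-1 ^+ n :> R by rewrite exprn_ge0// invr_ge0.
    apply: (@le_trans _ _ (- (C * 2^-1 ^+ n * t))).
      rewrite exprS lerN2 mulrAC ler_wpM2r//.
      by apply: (@le_trans _ _ (C * T)); [rewrite ler_wpM2l// ltW|rewrite CT mul1r].
    apply: (@slope_lower_bound (fun s => F (t0 + s) i) _ T) => //; last by rewrite t1.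
    - exact: ltW.
    - by rewrite mulr_ge0// ltW.
    - by rewrite addr0.
    - move=> e /(cont i)[d d0 hd]; exists d => // s h s0 hd'.
      by rewrite addrA; apply: hd => //; rewrite addr_ge0.
    - move=> s /andP[s0 sT] Fs e e0.
      have [||d d0 hd] := slope (t0 + s) (2^-1 ^+ n) i _ M0 _ Fs _ e0.
      + by rewrite addr_ge0.
      + by move=> j; apply: IHn; rewrite s0 ltW.
      by exists d => // h /hd; rewrite addrA.
  move=> t i tT; rewrite -oppr_le0; apply/ler_addgt0Pl => e e0.
  rewrite addr0; have [n hn] : exists n, 2^-1 ^+ n < e :> R.
    have : (fun n => 2^-1 ^+ n) @ \oo --> (0 : R).
      by apply: cvg_expr; rewrite ger0_norm ?invr_ge0// invf_lt1// ltr1n.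
    move/cvgrPdist_lt => /(_ _ e0)[n _ /(_ n (leqnn n))] /=.
    by rewrite sub0r normrN ger0_norm ?exprn_ge0 ?invr_ge0//; exists n.
  by rewrite lerNl (le_trans _ (geom n _ _ tT))// lerN2 ltW.
have windows n : forall t i, 0 <= t <= n%:R * T -> 0 <= F t i.
  elim: n => [|n IHn] t i /andP[t0 tn].
    by rewrite mul0r in tn; have -> : t = 0 by apply: le_anti; rewrite t0 tn.
  have nT : 0 <= n%:R * T by rewrite mulr_ge0// ltW.
  have [tn'|tn'] := leP t (n%:R * T); first by apply: IHn; rewrite t0.
  rewrite -(subrK (n%:R * T) t) addrC; apply: window => //.
    by move=> j; apply: IHn; rewrite nT lexx.
  by rewrite subr_ge0 ltW//= lerBlDr; move: tn; rewrite -natr1 mulrDl mul1r addrC.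
move=> t i t0; apply: (windows (Num.truncn (t / T)).+1); rewrite t0/=.
by rewrite -ler_pdivrMr// ltW// truncnS_gt.
Qed.
End minimum_principle.

(** * Coupling of two configurations that differ by one particle *)

Section coupling.
Variables (R : realType) (g : nat -> nat -> R).
Local Notation G := (rate_tail g).
Hypothesis g_ge0 : forall k a, 0 <= g k a.
Hypothesis tail_le : forall a l, G a l <= G a.+1 l.
Hypothesis tailS_le : forall a l, G a.+1 l.+1 <= G a l.

Lemma rate_tail_ge0 a l : 0 <= G a l.
Proof. exact: sumr_ge0. Qed.

Lemma rate_tailB k a : (0 < k)%N -> (k <= a)%N -> G a k.-1 - G a k = g k a.
Proof.
by case: k => // k _ ka; rewrite /rate_tail /= [X in X - _]big_ltn// addrK.
Qed.

Lemma rate_tail_out a : G a a = 0.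
Proof. by rewrite /rate_tail big_geq. Qed.

(** U k and V k are the values of a function after a jump of k particles from
    the larger and from the smaller of two configurations with a + 1 and a
    particles at the site. In the coupling either k particles jump from both, at
    rate together k, or k + 1 and k particles, at rate extra k; its total rate
    is G (a+1) 0. *)
Lemma coupled_sites (U V : nat -> R) (M : R) (a : nat) :
  0 <= M -> U 0%N <= V 0%N ->
  (forall k, (k <= a)%N -> - M <= U k - V k) ->
  (forall k, (k <= a)%N -> - M <= U k.+1 - V k) ->
  - M * G a.+1 0 <=
  \sum_(1 <= k < a.+2) g k a.+1 * (U k - U 0%N) -
  \sum_(1 <= k < a.+1) g k a * (V k - V 0%N).
Proof.
move=> M0 UV0 UV UV'.
pose together k := G a k.-1 - G a.+1 k.
pose extra k := G a.+1 k - G a k.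
have together0 k : (0 < k)%N -> 0 <= together k.
  by case: k => // k _; rewrite subr_ge0; apply: tailS_le.
have extra0 k : 0 <= extra k by rewrite subr_ge0.
have low : \sum_(1 <= k < a.+1) g k a * (V k - V 0%N) =
   \sum_(1 <= k < a.+1) together k * (V k - V 0%N) +
   \sum_(1 <= k < a.+1) extra k * (V k - V 0%N).
  rewrite -big_split/= [LHS]big_nat [RHS]big_nat; apply: eq_bigr => k /andP[k1 ka] /=.
  by rewrite -(rate_tailB k1 ka) /together /extra; ring.
have high : \sum_(1 <= k < a.+2) g k a.+1 * (U k - U 0%N) =
   \sum_(1 <= k < a.+1) together k * (U k - U 0%N) +
   \sum_(0 <= k < a.+1) extra k * (U k.+1 - U 0%N).
  (* together vanishes at a + 1, so the two sums over the larger site align *)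
  have -> : \sum_(1 <= k < a.+1) together k * (U k - U 0%N) =
      \sum_(1 <= k < a.+2) together k * (U k - U 0%N).
    by rewrite [RHS]big_nat_recr//= /together/= !rate_tail_out subrr mul0r addr0.
  have -> : \sum_(0 <= k < a.+1) extra k * (U k.+1 - U 0%N) =
      \sum_(1 <= k < a.+2) extra k.-1 * (U k - U 0%N).
    by rewrite [RHS]big_add1.
  rewrite -big_split/= [LHS]big_nat [RHS]big_nat; apply: eq_bigr => k /andP[k1 ka] /=.
  by rewrite -(rate_tailB k1 ka) /together /extra; ring.
have total : G a.+1 0 =
    \sum_(1 <= k < a.+1) together k + \sum_(0 <= k < a.+1) extra k.
  rewrite [X in _ + X]big_ltn// addrCA -big_split/=.
  have -> : \sum_(1 <= k < a.+1) (together k + extra k) = G a 0.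
    rewrite [RHS]/rate_tail big_nat [RHS]big_nat.
    apply: eq_bigr => k /andP[k1 ka].
    by rewrite -(rate_tailB k1 ka) /together /extra; ring.
  by rewrite /extra subrK.
(* the term k = 0 of the smaller site is no jump and contributes nothing *)
have lowE : \sum_(1 <= k < a.+1) extra k * (V k - V 0%N) =
    \sum_(0 <= k < a.+1) extra k * (V k - V 0%N).
  by rewrite [RHS]big_ltn// subrr mulr0 add0r.
rewrite low high total lowE opprD addrACA -!sumrB mulrDr !mulr_sumr.
have aux (x y z : R) : 0 <= x -> y <= z -> y * x <= x * z.
  by move=> x0 yz; rewrite mulrC ler_wpM2l.
apply: lerD; rewrite big_nat [leRHS]big_nat; apply: ler_sum => k /andP[k1 ka].
  rewrite -mulrBr; apply: aux; first exact: together0.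
  by have := UV k ka; lra.
rewrite -mulrBr; apply: aux; first exact: extra0.
by have := UV' k ka; lra.
Qed.

End coupling.

(** * Finite configurations *)

Section finite_configurations.
Variable X : countType.
Implicit Types (s t : seq X) (x y z : X).

(** The finite configuration in which each occurrence of x in s is a particle at
    x. Lists make the number of particles and the addition of one particle
    computable without reference to the support. *)
Definition confs s : conf X := fun x => count_mem x s.
Arguments confs : simpl never.

(** List form of a jump of k particles from x to y. *)
Definition moved s x y k :=
  [seq u <- s | u != x] ++ nseq (count_mem x s - k) x ++ nseq k y.

Lemma confs_cons z s x : confs (z :: s) x = ((z == x) + confs s x)%N.
Proof. by []. Qed.

Lemma confs_moved s x y k z : (k <= confs s x)%N ->
  confs (moved s x y k) z = (confs s z - (z == x) * k + (z == y) * k)%N.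
Proof.
move=> ks; rewrite /confs /moved !count_cat !count_nseq addnA /=.
rewrite [(x == z) in LHS]eq_sym [(y == z) in LHS]eq_sym; congr (_ + _)%N.
rewrite count_filter; have [->|zx] := eqVneq z x.
  rewrite (eq_count (a2 := pred0)) ?count_pred0//; first by rewrite !mul1n.
  by move=> u /=; case: eqVneq.
rewrite !mul0n subn0 addn0; apply: eq_count => u /=.
by case: eqVneq => // ->.
Qed.

Lemma size_moved s x y k : (k <= confs s x)%N -> size (moved s x y k) = size s.
Proof.
move=> ks; rewrite /moved !size_cat !size_nseq size_filter subnK//.
by rewrite addnC -(count_predC (pred1 x) s).
Qed.

Lemma jump_confs s x y k : (k <= confs s x)%N ->
  jump (confs s) x y k = confs (moved s x y k).
Proof. by move=> ks; apply/funext => z; rewrite confs_moved. Qed.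

Lemma jump_confs_cons z s x y k : (k <= confs s x)%N ->
  jump (confs (z :: s)) x y k = confs (z :: moved s x y k).
Proof.
move=> ks; apply/funext => u; rewrite confs_cons confs_moved// /jump confs_cons.
by case: (eqVneq u x) => [->|_]; lia.
Qed.

Lemma jump_confs_consS z s y k : (k <= confs s z)%N ->
  jump (confs (z :: s)) z y k.+1 = confs (y :: moved s z y k).
Proof.
move=> ks; apply/funext => u; rewrite confs_cons confs_moved// /jump confs_cons.
rewrite [y == u]eq_sym [z == u]eq_sym.
by case: (eqVneq u z) => [->|_]; case: (eqVneq _ y); lia.
Qed.

Lemma finite_confP (eta : conf X) : finite_conf eta -> exists s, eta = confs s.
Proof.
move=> fin; pose r := finmap.enum_fset (fset_set [set x | eta x <> 0%N]).
exists (flatten [seq nseq (eta x) x | x <- r]); apply/funext => x.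
rewrite /confs count_flatten -map_comp sumnE big_map.
have rE y : (y \in r) = (eta y != 0%N).
  rewrite /r in_fset_set//; apply/idP/idP; rewrite inE/=; first by move/eqP.
  by move/eqP.
have [xr|xr] := boolP (x \in r).
  rewrite (bigD1_seq x)//= ?finmap.fset_uniq// count_nseq/= eqxx mul1n big1 ?addn0//.
  by move=> y yx; rewrite /= count_nseq/= (negPf yx).
rewrite big_seq big1; first by move: xr; rewrite rE negbK => /eqP.
move=> y yr; rewrite /= count_nseq/=; case: eqVneq => // yx.
by rewrite -yx yr in xr.
Qed.

Lemma finite_confs s : finite_conf (confs s).
Proof.
apply: (@sub_finite_set _ _ [set` s]); last exact: finite_seq.
by move=> x /= /eqP; rewrite -lt0n -has_count has_pred1.
Qed.

Lemma conf_le_confs (eta zeta : conf X) : finite_conf zeta ->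
  conf_le eta zeta -> exists s t, eta = confs s /\ zeta = confs (t ++ s).
Proof.
move=> fz le_ez.
have fe : finite_conf eta.
  apply: sub_finite_set fz => x /= /eqP; rewrite -lt0n => ex.
  by apply/eqP; rewrite -lt0n (leq_trans ex).
have fd : finite_conf (fun x => zeta x - eta x)%N.
  apply: sub_finite_set fz => x /= /eqP; rewrite -lt0n => ex.
  by apply/eqP; rewrite -lt0n (leq_trans ex)// leq_subr.
have [s es] := finite_confP fe; have [t et] := finite_confP fd.
exists s, t; split => //; apply/funext => x; rewrite /confs count_cat.
rewrite -/(confs s x) -/(confs t x) -es -et subnK//; exact: le_ez.
Qed.

(** There are at most size s occupied sites, each with at most size s
    particles. *)
Lemma sum_confs_le (R : realType) (h : nat -> R) (s : seq X) :
  h 0%N = 0 -> (forall a, 0 <= h a) ->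
  \sum_(x <- undup s) h (confs s x) <= (size s)%:R * \sum_(a < (size s).+1) h a.
Proof.
move=> h0 hge; apply: (@le_trans _ _ (\sum_(x <- undup s) \sum_(a < (size s).+1) h a)).
  apply: ler_sum => x _; have xs : (confs s x < (size s).+1)%N by apply: count_size.
  by rewrite (bigD1 (Ordinal xs))//= lerDl sumr_ge0.
rewrite big_const_seq count_predT iter_addr_0 -[leLHS]mulr_natl.
rewrite ler_wpM2r ?sumr_ge0//.
by rewrite ler_nat size_undup.
Qed.

End finite_configurations.
Arguments confs : simpl never.

(** * The generator along the coupling *)

Section generator_bound.
Variables (R : realType) (X : countType) (p : X -> X -> R) (g : nat -> nat -> R).
Local Notation G := (rate_tail g).
Hypothesis p_prob : transition_probability p.
Hypothesis g_ge0 : forall k a, 0 <= g k a.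
Hypothesis tail_le : forall a l, G a l <= G a.+1 l.
Hypothesis tailS_le : forall a l, G a.+1 l.+1 <= G a l.

(** A bound for the total jump rate from a configuration with n particles; that
    it depends on n alone makes the minimum principle applicable. *)
Definition total_rate n : R := n%:R * \sum_(a < n.+1) G a 0.

Lemma jump_rates_summable (s : seq X) :
  asummable (fun xy : X * X => p xy.1 xy.2 * G (confs s xy.1) 0) /\
  dsum (fun xy : X * X => p xy.1 xy.2 * G (confs s xy.1) 0) <= total_rate (size s).
Proof.
have [p0 p1] := p_prob.
have G0 a : 0 <= G a 0 by apply: rate_tail_ge0.
have sp x : asummable (p x).
  apply/asummableE; under eq_esum do rewrite ger0_norm//.
  by rewrite p1 ltry.
have dp x : dsum (p x) = 1.
  by apply: EFin_inj; rewrite -dsum_esum// p1.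
have out x : x \notin undup s -> G (confs s x) 0 = 0.
  rewrite mem_undup => /count_memPn; rewrite /confs => ->.
  by rewrite /rate_tail big_geq.
have pG0 xy : 0 <= p xy.1 xy.2 * G (confs s xy.1) 0 by rewrite mulr_ge0.
have E : (\esum_(xy in [set: X * X]) (p xy.1 xy.2 * G (confs s xy.1) 0)%:E =
    (\sum_(x <- undup s) G (confs s x) 0)%:E)%E.
  transitivity (\esum_(x in [set: X]) \esum_(y in [set: X])
      (p x y * G (confs s x) 0)%:E)%E.
    rewrite (esum_esum (a := fun x y => (p x y * G (confs s x) 0)%:E)).
      by congr esum; apply/seteqP; split => // -[x y].
    by move=> x y _ _; rewrite lee_fin mulr_ge0.
  rewrite -(dsum_seq (undup_uniq s) out) -dsum_esum//; last exact: asummable_seq out.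
  apply: eq_esum => x _; rewrite dsum_esum//.
  - by under eq_dsum do rewrite mulrC; rewrite dsumZ// dp mulr1.
  - by move=> y; rewrite mulr_ge0.
  - by under eq_fun do rewrite mulrC; apply: asummableZ.
have sm : asummable (fun xy : X * X => p xy.1 xy.2 * G (confs s xy.1) 0).
  apply/asummableE; under eq_esum do rewrite ger0_norm//.
  by rewrite E ltry.
split => //; rewrite -lee_fin -dsum_esum// E lee_fin /total_rate.
apply: (@sum_confs_le _ _ (fun a => G a 0)) => //.
by rewrite /rate_tail big_geq.
Qed.

(** Away from z the same jumps occur in both configurations; at z they are
    coupled by [coupled_sites]. Every coupled jump leads to a pair that again
    differs by one particle, where the increment of u is at least -M, and the
    increment of u before the jump is nonpositive. *)
Lemma generator_difference_ge (u : conf X -> R) (M : R) (s : seq X) (z : X) :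
  0 <= M ->
  (forall s' z', size s' = size s -> - M <= u (confs (z' :: s')) - u (confs s')) ->
  u (confs (z :: s)) <= u (confs s) ->
  asummable (generator_term p g u (confs (z :: s))) ->
  asummable (generator_term p g u (confs s)) ->
  - (M * total_rate (size s).+1) <=
    generator p g u (confs (z :: s)) - generator p g u (confs s).
Proof.
move=> M0 low le_u s1 s0.
have [p0 _] := p_prob; have [sr leC] := jump_rates_summable (z :: s).
rewrite /generator -dsumB//.
apply: (@le_trans _ _ (- M * dsum (fun xy => p xy.1 xy.2 * G (confs (z :: s) xy.1) 0))).
  by rewrite mulNr lerN2 ler_wpM2l.
rewrite -dsumZ//; apply: ler_dsum; [|exact: asummableZ|exact: asummableB].
move=> [x y]; rewrite /generator_term /= -mulrBr mulrCA ler_wpM2l//.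
have [<-|zx] := eqVneq z x.
  have Ez : confs (z :: s) z = (confs s z).+1 by rewrite confs_cons eqxx.
  have j0 (eta : conf X) : jump eta z y 0 = eta.
    by apply/funext => v; rewrite /jump !muln0 subn0 addn0.
  rewrite Ez.
  have := @coupled_sites R g tail_le tailS_le
    (fun k => u (jump (confs (z :: s)) z y k)) (fun k => u (jump (confs s) z y k))
    M (confs s z) M0.
  rewrite !j0; apply=> // k ka.
    by rewrite jump_confs_cons// jump_confs//; apply: low; rewrite size_moved.
  by rewrite jump_confs_consS// jump_confs//; apply: low; rewrite size_moved.
have -> : confs (z :: s) x = confs s x by rewrite confs_cons (negPf zx).
rewrite -sumrB /rate_tail mulr_sumr big_nat [leRHS]big_nat.
apply: ler_sum => k /andP[k1 ka].
rewrite -mulrBr mulrC ler_wpM2l// jump_confs_cons// jump_confs//.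
have := low (moved s x y k) z; rewrite size_moved// => /(_ erefl).
by move: le_u; lra.
Qed.

End generator_bound.

(** * Transition probabilities and the backward equation *)

Lemma near_right0P (R : realType) (Q : R -> Prop) :
  (\forall h \near 0^'+, Q h) -> exists2 d, 0 < d & forall h, 0 < h < d -> Q h.
Proof.
rewrite /at_right /within /= => -[d /= d0 hd]; exists d => // h /andP[h0 hd'].
by apply: hd => //=; rewrite sub0r normrN gtr0_norm.
Qed.

(** The integral of a nonnegative function is the integral of the measures of
    its level sets; f + M is nonnegative. *)
Lemma stochastic_dominance_le (R : realType) d (T : measurableType d)
    (mu nu : probability T R) (S : set T) (f : T -> R) (M : R) :
  measurable S -> mu S = 1%E -> nu S = 1%E ->
  (forall x, S x -> `|f x| <= M) -> measurable_fun S f ->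
  (forall r : R,
     (mu (S `&` [set x | (r < f x)%R]) <= nu (S `&` [set x | (r < f x)%R]))%E) ->
  Rintegral mu S f <= Rintegral nu S f.
Proof.
move=> mS muS nuS fM mf dom.
pose X : T -> R := (fun x => f x + M) \_ S.
have mX : measurable_fun [set: T] X.
  by apply/(measurable_restrictT _ mS); apply: measurable_funD.
have X0 x : 0 <= X x.
  rewrite /X patchE; case: ifP => // /set_mem /fM.
  by rewrite ler_norml; lra.
have bdf : [bounded f x | x in S].
  exists M; split; first exact: num_real.
  by move=> K MK x /= /fM fx; apply: le_trans fx (ltW MK).
have int_f (la : probability T R) : la.-integrable S (EFin \o f).
  apply: measurable_bounded_integrable => //.
  by apply: (le_lt_trans (probability_le1 _ _)) => //; rewrite ltry.
have int_c (la : probability T R) : la.-integrable S (EFin \o cst M).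
  by apply: finite_measure_integrable_cst.
have shift (la : probability T R) : la S = 1%E ->
    fine (\int[la]_x (X x)%:E) = Rintegral la S f + M.
  move=> laS; rewrite -/(Rintegral la setT X) /X -Rintegral_mkcond RintegralD//.
  - by rewrite Rintegral_cst// (_ : fine _ = 1) ?mulr1//; exact: (congr1 fine laS).
  - exact: int_f.
  - exact: int_c.
have mX' : X \in mfun by rewrite inE.
pose XR : {mfun T >-> R} := mfun_Sub mX'.
have E (la : probability T R) : (\int[la]_x (X x)%:E =
    \int[lebesgue_measure]_(r in `[0%R, +oo[) ccdf (XR : {RV la >-> R}) r)%E.
  by rewrite -ge0_expectation_ccdf// expectation_def.
have int_X (la : probability T R) : la.-integrable setT (EFin \o X).
  apply: measurable_bounded_integrable => //.
    by apply: (le_lt_trans (probability_le1 _ _)) => //; rewrite ltry.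
  exists (2 * `|M|); split; first exact: num_real.
  move=> K MK x _ /=; apply: le_trans (ltW MK).
  rewrite ger0_norm// /X patchE; case: ifP => [/set_mem /fM fx|_]; last first.
    by rewrite mulr_ge0.
  by have := ler_norm (f x); have := ler_norm M; lra.
rewrite -(lerD2r M) -!shift// fine_le//.
- apply: integrable_fin_num => //; exact: int_X.
- apply: integrable_fin_num => //; exact: int_X.
rewrite !E; apply: ge0_le_integral => //.
- by apply: measurable_funTS; apply: ccdf_measurable.
- by apply: measurable_funTS; apply: ccdf_measurable.
move=> r; rewrite /= in_itv/= andbT => r0.
have ccdfE (la : probability T R) : ccdf (XR : {RV la >-> R}) r =
    la (S `&` [set x | (r - M < f x)%R]).
  rewrite /ccdf /distribution /pushforward; congr (la _); apply/seteqP; split => x /=.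
    rewrite in_itv/= andbT /X patchE; case: ifPn => [/set_mem Sx|_].
      by rewrite ltrBlDr.
    by move=> /(le_lt_trans r0); rewrite ltxx.
  by move=> [Sx]; rewrite in_itv/= andbT /X patchE mem_set// ltrBlDr.
by rewrite !ccdfE.
Qed.

Section transition.
Variables (R : realType) (X : countType) (p : X -> X -> R) (g : nat -> nat -> R).
Variables (S : set (conf X)) (P : R -> conf X -> probability (bconf X) R).
Hypothesis mm : mm_zrp p g S P.
Implicit Types (A : set (bconf X)) (eta : conf X).

Definition trans_prob A (t : R) : conf X -> R := fun eta => fine (P t eta A).

Let mS : measurable (S : set (bconf X)) := mm_zrp_measurable mm.

Lemma trans_prob01 A t eta : measurable A -> 0 <= trans_prob A t eta <= 1.
Proof.
move=> mA; rewrite /trans_prob fine_ge0//= -lee_fin fineK ?probability_le1//.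
exact: fin_num_measure.
Qed.

Lemma trans_prob_measurable A t : 0 <= t -> measurable A ->
  measurable_fun (S : set (bconf X)) (trans_prob A t : bconf X -> R).
Proof.
move=> t0 mA; apply: (measurableT_comp (f := fine)); first exact: fine_measurable.
exact: (mm_zrp_kernel mm).
Qed.

Lemma trans_prob_bounded A t : measurable A -> bounded_on S (trans_prob A t).
Proof.
move=> mA; exists 1 => eta _.
by have /andP[? ?] := trans_prob01 t eta mA; rewrite ger0_norm.
Qed.

Lemma trans_prob0 A eta : S eta -> measurable A ->
  trans_prob A 0 eta = (eta \in (A : set (conf X)))%:R.
Proof. by move=> Se mA; rewrite /trans_prob (mm_zrp_0 mm)//= diracE. Qed.

Lemma trans_prob_semigroup A s t eta : 0 <= s -> 0 <= t -> S eta -> measurable A ->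
  semigroup S P s (trans_prob A t) eta = trans_prob A (s + t) eta.
Proof.
move=> s0 t0 Se mA; rewrite /semigroup /Rintegral /trans_prob (mm_zrp_markov mm)//.
congr fine; apply: eq_integral => zeta _; rewrite fineK//.
exact: fin_num_measure.
Qed.

(** Backward equation: P_{t+h} = P_h P_t, and the function P_t(., A) is bounded
    and measurable, hence in the domain of the generator at finite
    configurations. *)
Lemma trans_prob_slope A t eta : 0 <= t -> finite_conf eta -> measurable A ->
  asummable (generator_term p g (trans_prob A t) eta) /\
  (trans_prob A (t + h) eta - trans_prob A t eta) / h @[h --> 0^'+] -->
    generator p g (trans_prob A t) eta.
Proof.
move=> t0 fe mA; have Se := mm_zrp_finite mm fe.
have [//||sm cv] := mm_zrp_generator mm (f := trans_prob A t) Se.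
- exact: trans_prob_bounded.
- by right; split => //; exact: trans_prob_measurable.
split=> //; apply: cvg_trans cv; apply: near_eq_cvg; near=> h.
have h0 : 0 <= h by near: h; exact: nbhs_right_ge.
by rewrite trans_prob_semigroup// [h + t]addrC.
Unshelve. all: by end_near. Qed.

Lemma bounded_on_integrable (la : probability (bconf X) R) (f : conf X -> R) :
  bounded_on S f -> measurable_fun (S : set (bconf X)) (f : bconf X -> R) ->
  la.-integrable (S : set (bconf X)) (EFin \o (f : bconf X -> R)).
Proof.
move=> [M fM] mf; apply: measurable_bounded_integrable => //.
  by apply: (le_lt_trans (probability_le1 _ _)) => //; rewrite ltry.
exists M; split; first exact: num_real.
by move=> K MK x /= /fM fx; apply: le_trans fx (ltW MK).
Qed.

Lemma measurable_conf1 eta : measurable ([set eta] : set (bconf X)).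
Proof.
rewrite -[X in measurable X]setCK; apply: measurableC.
apply: sub_sigma_algebra; apply: closed_openC.
apply: accessible_closed_set1; apply: hausdorff_accessible.
by apply: hausdorff_product => x; exact: discrete_hausdorff.
Qed.

(** |P_{t+h}(eta, A) - P_t(eta, A)| is at most the probability of having left
    eta at time h, which is of order h. The bound is uniform in t, so that it
    yields left continuity as well, which right derivatives alone do not give. *)
Lemma trans_prob_continuous eta (e : R) : finite_conf eta -> 0 < e ->
  exists2 d, 0 < d & forall A t h, measurable A -> 0 <= t -> 0 <= h < d ->
    `|trans_prob A (t + h) eta - trans_prob A t eta| <= e.
Proof.
move=> fe e0; have Se := mm_zrp_finite mm fe.
pose f : conf X -> R := \1_[set eta].
have mf : measurable_fun (S : set (bconf X)) (f : bconf X -> R).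
  by apply: measurable_indic; exact: measurable_conf1.
have f01 zeta : 0 <= f zeta <= 1.
  by rewrite /f indicE; case: (_ \in _); rewrite ?lexx ?ler01.
have bf : bounded_on S f.
  by exists 1 => zeta _; have /andP[? ?] := f01 zeta; rewrite ger0_norm.
(* P_t applied to the indicator of eta has a right derivative at time 0,
   so that the probability of staying at eta is 1 - O(h) *)
have [_] := mm_zrp_generator mm Se bf (or_intror (conj fe mf)).
move: (generator _ _ _ _) => d /cvgrPdist_lt /(_ _ ltr01) /near_right0P[d1 d10 hd1].
have fe1 : f eta = 1 by rewrite /f indicE mem_set.
have stay h : 0 < h < d1 -> 1 - semigroup S P h f eta <= (`|d| + 1) * h.
  move=> /[dup] /andP[h0 _] /hd1 /=; rewrite fe1 -ler_pdivrMr// => lt1.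
  rewrite -opprB mulNr; have := ler_norm (d - (semigroup S P h f eta - 1) / h).
  by have := ler_norm (- d); rewrite normrN; lra.
have dd : 0 < `|d| + 1 by rewrite ltr_wpDl.
exists (Num.min d1 (e / (`|d| + 1))); first by rewrite lt_min d10 divr_gt0.
move=> A t h mA t0; rewrite lt_min => /andP[h0 /andP[hd he]].
move: h0; rewrite le_eqVlt => /predU1P[<-|h0]; first by rewrite addr0 subrr normr0 ltW.
apply: (@le_trans _ _ (1 - semigroup S P h f eta)); last first.
  apply: le_trans (stay h _) _; first by rewrite h0.
  by rewrite -ler_pdivlMl// mulrC ltW.
have PS : fine (P h eta S) = 1 by rewrite (mm_zrp_in mm) ?ltW.
have cstE (c : R) : Rintegral (P h eta) (S : set (bconf X)) (fun=> c) = c.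
  by rewrite Rintegral_cst// (_ : fine _ = 1) ?mulr1.
have icst (c : R) : (P h eta).-integrable (S : set (bconf X)) (EFin \o (fun=> c)).
  by apply: finite_measure_integrable_cst.
have it : (P h eta).-integrable (S : set (bconf X))
    (EFin \o (trans_prob A t : bconf X -> R)).
  by apply: bounded_on_integrable; [exact: trans_prob_bounded|exact: trans_prob_measurable].
have if_ : (P h eta).-integrable (S : set (bconf X)) (EFin \o (f : bconf X -> R)).
  exact: bounded_on_integrable.
have iB (u v : bconf X -> R) :
    (P h eta).-integrable (S : set (bconf X)) (EFin \o u) ->
    (P h eta).-integrable (S : set (bconf X)) (EFin \o v) ->
    (P h eta).-integrable (S : set (bconf X)) (EFin \o (fun x => u x - v x)).
  by move=> iu iv; exact: (integrableB mS iu iv).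
rewrite [t + h]addrC -trans_prob_semigroup ?(ltW h0)//.
rewrite -[X in `|_ - X|]cstE -[X in _ <= X - _]cstE /semigroup.
rewrite -!RintegralB//; apply: (le_trans (le_normr_Rintegral _ _)) => //.
  by apply: iB.
apply: le_Rintegral => //.
- exact: (integrable_abse (iB _ _ it (icst _))).
- by apply: iB.
move=> zeta _.
have /andP[u0 u1] := trans_prob01 t zeta mA; have /andP[v0 v1] := trans_prob01 t eta mA.
rewrite -/(trans_prob A t zeta); case: (boolP (zeta \in [set eta])) => [/set_mem ->|_].
  by rewrite !subrr normr0.
by rewrite mulr0n subr0 ler_norml; apply/andP; split; lra.
Qed.

End transition.

(** * Attractiveness from the inequalities between tails *)

Section attractiveness.
Variables (R : realType) (X : countType) (p : X -> X -> R) (g : nat -> nat -> R).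
Local Notation G := (rate_tail g).
Hypothesis p_prob : transition_probability p.
Hypothesis g_ge0 : forall k a, 0 <= g k a.
Hypothesis tail_le : forall a l, G a l <= G a.+1 l.
Hypothesis tailS_le : forall a l, G a.+1 l.+1 <= G a l.
Variables (S : set (conf X)) (P : R -> conf X -> probability (bconf X) R).
Hypothesis mm : mm_zrp p g S P.

Let S_confs s : S (confs s).
Proof. by apply: (mm_zrp_finite mm); exact: finite_confs. Qed.

(** The minimum principle for the increments at a given number of particles.
    Adding a single particle at a time keeps the family stable under the
    coupling. *)
Lemma trans_prob_confs_cons (A : set (bconf X)) (t : R) s z :
  0 <= t -> measurable A ->
  (forall s z, A (confs s) -> A (confs (z :: s))) ->
  trans_prob P A t (confs s) <= trans_prob P A t (confs (z :: s)).
Proof.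
move=> t0 mA incrA; pose N := size s.
pose F (t : R) (i : N.-tuple X * X) :=
  trans_prob P A t (confs (i.2 :: i.1)) - trans_prob P A t (confs i.1).
have C0 : 0 <= total_rate g N.+1.
  by rewrite mulr_ge0// sumr_ge0// => a _; exact: rate_tail_ge0.
suff : 0 <= F t (in_tuple s, z) by rewrite subr_ge0.
apply: (@family_minimum_principle _ _ F (total_rate g N.+1 + 1)) => //.
- by rewrite ltr_wpDl.
- move=> u i _; have /andP[a0 a1] := trans_prob01 P u (confs i.1) mA.
  by have /andP[b0 b1] := trans_prob01 P u (confs (i.2 :: i.1)) mA; rewrite /F; lra.
- move=> i; rewrite /F !(trans_prob0 mm)// subr_ge0 ler_nat.
  case: (boolP (_ \in (A : set (conf X)))) => // /set_mem /incrA => /(_ i.2) h.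
  by rewrite mem_set.
- move=> i e e0; have e2 : 0 < e / 2 by lra.
  have [d1 d10 h1] := trans_prob_continuous mm (finite_confs i.1) e2.
  have [d2 d20 h2] := trans_prob_continuous mm (finite_confs (i.2 :: i.1)) e2.
  exists (Num.min d1 d2); first by rewrite lt_min d10.
  move=> u h u0; rewrite lt_min => /and3P[h0 hd1 hd2].
  have := h1 A u h mA u0; rewrite h0 hd1 => /(_ isT).
  have := h2 A u h mA u0; rewrite h0 hd2 => /(_ isT).
  by rewrite /F !ler_norml => /andP[? ?] /andP[? ?]; lra.
- move=> u M [r y] u0 M0 low; rewrite /F/= subr_le0 => le_u e e0.
  have [s1 c1] := trans_prob_slope mm u0 (finite_confs (y :: r)) mA.
  have [s2 c2] := trans_prob_slope mm u0 (finite_confs r) mA.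
  have D : - (M * total_rate g N.+1) <=
      generator p g (trans_prob P A u) (confs (y :: r)) -
      generator p g (trans_prob P A u) (confs r).
    have sr : size r = N by rewrite size_tuple.
    rewrite -[in total_rate _ _]sr; apply: generator_difference_ge => // s' z'.
    rewrite sr => /eqP s'N.
    exact: (low (Tuple s'N, z')).
  have : (fun h =>
      (trans_prob P A (u + h) (confs (y :: r)) -
       trans_prob P A u (confs (y :: r))) / h - (trans_prob P A (u + h) (confs r) - trans_prob P A u (confs r)) / h) @ 0^'+ -->
      generator p g (trans_prob P A u) (confs (y :: r)) -
      generator p g (trans_prob P A u) (confs r) by exact: cvgB.
  move=> /cvgrPdist_lt /(_ _ e0) /near_right0P[d d0 hd].
  exists d => // h /[dup] /andP[h0 _] /hd; rewrite -mulrBl.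
  move: D; move: (generator p g _ _ - _) => dgen D.
  set num := (X in X / h).
  move=> /ltr_normlW; rewrite ltrBlDr => lt1.
  have : - (M * total_rate g N.+1) - e <= num / h by lra.
  rewrite ler_pdivlMr// /num => le1.
  have : 0 <= M * h by rewrite mulr_ge0// ltW.
  by move: le1; rewrite !(mulrDl, mulrBl, mulNr, mulrDr, mul1r); nra.
Qed.

Lemma trans_prob_conf_le (A : set (bconf X)) (t : R) (eta zeta : conf X) :
  0 <= t -> measurable A ->
  (forall s z, A (confs s) -> A (confs (z :: s))) ->
  finite_conf zeta -> conf_le eta zeta ->
  trans_prob P A t eta <= trans_prob P A t zeta.
Proof.
move=> t0 mA incrA fz le_ez; have [s [r [-> ->]]] := conf_le_confs fz le_ez.
by elim: r => //= z r /le_trans; apply; exact: trans_prob_confs_cons.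
Qed.

Lemma continuous_within_measurable (f : conf X -> R) :
  {within S, continuous f} ->
  measurable_fun (S : set (bconf X)) (f : bconf X -> R).
Proof.
move=> /continuousP cf mS; apply: (measurability _ (RGenOpens.measurableE R)); last exact: mS.
move=> _ [_ [a [b ->] <-]].
have /cf/open_subspaceP[V oV VS] : open `]a, b[%classic by exact: interval_open.
rewrite setIC -VS; apply: measurableI => //; exact: sub_sigma_algebra.
Qed.

(** The level sets of f are increasing, so [trans_prob_conf_le] is a stochastic
    domination between P t eta and P t zeta. *)
Lemma semigroup_monotone_finite (f : conf X -> R) (t : R) (eta zeta : conf X) :
  bounded_on S f -> monotone_on S f ->
  measurable_fun (S : set (bconf X)) (f : bconf X -> R) ->
  0 <= t -> finite_conf zeta -> conf_le eta zeta ->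
  semigroup S P t f eta <= semigroup S P t f zeta.
Proof.
move=> [M fM] monof mf t0 fz le_ez.
have mS := mm_zrp_measurable mm.
have [s [r [es er]]] := conf_le_confs fz le_ez.
have Se : S eta by rewrite es.
have Sz : S zeta by rewrite er.
apply: (stochastic_dominance_le mS _ _ fM mf).
- exact: mm_zrp_in mm _ _ t0 Se.
- exact: mm_zrp_in mm _ _ t0 Sz.
move=> a; set A := (X in P t eta X).
have mA : measurable A.
  have := mf mS `]a, +oo[%classic (measurable_itv _).
  by congr measurable; apply/seteqP; split => x [Sx]/=; rewrite in_itv/= andbT.
have /(trans_prob_conf_le t0 mA) : forall s z, A (confs s) -> A (confs (z :: s)).
  move=> s' z [Ss' af]; split; first exact: S_confs.
  apply: lt_le_trans af _; apply: monof => // x.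
  by rewrite confs_cons leq_addl.
move=> /(_ _ _ fz le_ez).
by rewrite -lee_fin !fineK//; exact: fin_num_measure.
Qed.

(** The sites are enumerated by pickle; for every n this is a finite
    configuration below eta. *)
Definition truncate_conf n (eta : conf X) : conf X :=
  fun x => if (pickle x < n)%N then eta x else 0%N.

Lemma truncate_conf_finite n eta : finite_conf (truncate_conf n eta).
Proof.
apply: (@sub_finite_set _ _ ((@pickle X) @^-1` `I_n)).
  by move=> x /=; rewrite /truncate_conf; case: ifP.
apply: finite_preimage; last exact: finite_II.
by move=> x y _ _; apply: (pcan_inj pickleK).
Qed.

Lemma truncate_conf_cvg eta : truncate_conf n eta @[n --> \oo] --> eta.
Proof.
rewrite cvg_sup => x.
rewrite cvg_image; last by rewrite eqEsubset; split=> v // _; exists (cst v).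
move=> W Wx; exists (@^~ x @^-1` W); last first.
  by rewrite eqEsubset; split => [j [? + <-//]|j Wj]; exists (fun=> j).
exists (pickle x).+1 => // n /= xn.
by rewrite /truncate_conf xn; exact: nbhs_singleton Wx.
Qed.

(** Finite configurations are dense in S from below, and S(t) f is continuous
    on S by the Feller property. *)
Theorem attractive_of_tails : attractive S P.
Proof.
move=> f [M fM] monof cf t t_gt0; have t0 := ltW t_gt0.
have mS := mm_zrp_measurable mm.
have bf : bounded_on S f by exists M.
have mf : measurable_fun (S : set (bconf X)) (f : bconf X -> R).
  exact: continuous_within_measurable.
have cSf := mm_zrp_feller mm t0 bf cf.
split => //.
- exists M => eta Se; rewrite /semigroup.
  have int_f := bounded_on_integrable mm (P t eta) bf mf.
  apply: (le_trans (le_normr_Rintegral mS int_f)).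
  have PS : fine (P t eta S) = 1 by rewrite (mm_zrp_in mm).
  have <- : Rintegral (P t eta) (S : set (bconf X)) (fun=> M) = M.
    by rewrite Rintegral_cst// (_ : fine _ = 1) ?mulr1.
  apply: le_Rintegral => //; first exact: (integrable_abse int_f).
  exact: finite_measure_integrable_cst.
move=> eta zeta Se Sz le_ez.
have cvS (xi : conf X) : S xi ->
    semigroup S P t f (truncate_conf n xi) @[n --> \oo] --> semigroup S P t f xi.
  move=> Sxi; have /subspace_continuousP/(_ _ Sxi) := cSf.
  apply: cvg_comp => B SB.
  have nB : \forall n \near \oo, S (truncate_conf n xi) -> B (truncate_conf n xi).
    exact: (@truncate_conf_cvg xi _ SB).
  change (\forall n \near \oo, B (truncate_conf n xi)).
  apply: filterS nB => n; apply.
  exact: (mm_zrp_finite mm (truncate_conf_finite n xi)).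
apply: (ler_cvg_to (cvS _ Se) (cvS _ Sz)); apply: nearW => n.
apply: semigroup_monotone_finite => //; first exact: truncate_conf_finite.
by move=> x; rewrite /truncate_conf; case: ifP.
Qed.

End attractiveness.

(** * The stationary distribution on finitely many sites *)

Section configurations_in_a_box.
Variable L : nat.
Implicit Types (eta xi zeta : {ffun 'I_L -> nat}) (x y : 'I_L) (k N : nat).

(** A list that contains all configurations with N particles, so that sums over
    these become finite sums. *)
Definition box N : seq {ffun 'I_L -> nat} :=
  [seq [ffun i => nat_of_ord (e i)] | e : {ffun 'I_L -> 'I_N.+1}].

Lemma box_uniq N : uniq (box N).
Proof.
rewrite map_inj_uniq ?enum_uniq// => e e' /ffunP ee; apply/ffunP => i.
by have := ee i; rewrite !ffunE => /val_inj.
Qed.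

Lemma mem_box N eta : (eta \in box N) = [forall i, eta i <= N]%N.
Proof.
apply/fintype.imageP/forallP => [[e _ ->] i|le_eN].
  by rewrite ffunE -ltnS.
exists [ffun i => inord (eta i)] => //.
by apply/ffunP => i; rewrite !ffunE inordK// ltnS.
Qed.

Lemma particles_box N eta : particles eta = N -> eta \in box N.
Proof.
move=> <-; rewrite mem_box; apply/forallP => i.
by rewrite /particles (bigD1 i)//= leq_addr.
Qed.

Definition take_out eta x k := [ffun z => eta z - (z == x) * k]%N.
Definition put_in xi y k := [ffun z => xi z + (z == y) * k]%N.

Lemma take_outK eta x k : (k <= eta x)%N -> put_in (take_out eta x k) x k = eta.
Proof.
move=> kx; apply/ffunP => z; rewrite !ffunE.
by case: eqVneq => [->|_]; [rewrite mul1n subnK|rewrite mul0n subn0 addn0].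
Qed.

Lemma put_inK xi x k : take_out (put_in xi x k) x k = xi.
Proof. by apply/ffunP => z; rewrite !ffunE addnK. Qed.

Lemma put_in_ge xi x k : (k <= put_in xi x k x)%N.
Proof. by rewrite ffunE eqxx mul1n leq_addl. Qed.

Lemma particles_put_in xi y k : particles (put_in xi y k) = (particles xi + k)%N.
Proof.
rewrite /particles; under eq_bigr do rewrite ffunE.
rewrite big_split/=; congr (_ + _)%N.
by rewrite (bigD1 y)//= eqxx mul1n big1 ?addn0// => z /negPf ->.
Qed.

Lemma jump_ffun eta x y k :
  jump (eta : 'I_L -> nat) x y k = put_in (take_out eta x k) y k.
Proof. by apply/funext => z; rewrite /jump !ffunE. Qed.

Lemma particles_jump eta x y k : (k <= eta x)%N ->
  particles (put_in (take_out eta x k) y k) = particles eta.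
Proof.
by move=> kx; rewrite -[in RHS](take_outK kx) !particles_put_in.
Qed.

(** Removing k particles from x is a bijection from the configurations with N
    particles, at least k of them at x, onto those with N - k particles. *)
Lemma sum_box_take_out (R : realType) (H : {ffun 'I_L -> nat} -> R) N x k :
  \sum_(eta <- box N | (particles eta == N) && (k <= eta x)%N)
     H (take_out eta x k) =
  \sum_(xi <- box N | (particles xi + k == N)%N) H xi.
Proof.
rewrite -big_filter -[RHS]big_filter -(big_map (fun eta => take_out eta x k) predT H).
apply: perm_big; apply: uniq_perm.
- rewrite map_inj_in_uniq ?filter_uniq ?box_uniq// => eta zeta.
  rewrite !mem_filter => /andP[/andP[_ ke] _] /andP[/andP[_ kz] _] E.
  by rewrite -(take_outK ke) -(take_outK kz) E.
- by rewrite filter_uniq// box_uniq.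
move=> xi; rewrite mem_filter; apply/mapP/andP.
  move=> [eta]; rewrite mem_filter => /andP[/andP[/eqP pN ke] eN] ->.
  split; first by rewrite -(particles_put_in _ x) take_outK// pN.
  rewrite mem_box; apply/forallP => i; rewrite ffunE.
  by rewrite (leq_trans (leq_subr _ _))//; move: eN; rewrite mem_box => /forallP.
move=> [/eqP pN xiN]; exists (put_in xi x k); last by rewrite put_inK.
rewrite mem_filter particles_put_in pN eqxx put_in_ge/=.
by apply: particles_box; rewrite particles_put_in.
Qed.

End configurations_in_a_box.

Section stationarity.
Variables (R : realType) (L : nat) (q : nat -> R) (g : nat -> nat -> R).
Hypothesis q_gt0 : forall n, 0 < q n.
Hypothesis gE : forall k a, (1 <= k <= a)%N -> g k a = q (a - k)%N * q k / q a.
Variable p : 'I_L -> 'I_L -> R.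
Hypothesis p_prob : transition_probability p.
Hypothesis p_col : forall y, \sum_(x < L) p x y = 1.
Implicit Types (eta xi zeta : {ffun 'I_L -> nat}) (x y : 'I_L) (k N : nat).

Definition weight eta : R := \prod_i q (eta i).

Lemma weight_gt0 eta : 0 < weight eta.
Proof. by apply: prodr_gt0. Qed.

Let p_row x : \sum_y p x y = 1.
Proof.
have [p0 p1] := p_prob; apply: EFin_inj; rewrite -(p1 x) -dsum_fin dsum_esum//.
exact: asummable_fin.
Qed.

Lemma weight_rate eta x k : (1 <= k <= eta x)%N ->
  weight eta * g k (eta x) = q k * weight (take_out eta x k).
Proof.
move=> kx; rewrite gE// /weight (bigD1 x)//= [in RHS](bigD1 x)//=.
have -> : \prod_(i < L | i != x) q (take_out eta x k i) =
          \prod_(i < L | i != x) q (eta i).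
  by apply: eq_bigr => i /negPf ix; rewrite ffunE ix mul0n subn0.
rewrite ffunE eqxx mul1n; move: (\prod_(_ < _ | _) _) => r.
by field; rewrite gt_eqF.
Qed.

Lemma generatorE (f : conf 'I_L -> R) eta : generator p g f (eta : 'I_L -> nat) =
  \sum_x \sum_y p x y * \sum_(1 <= k < (eta x).+1)
    g k (eta x) * (f (put_in (take_out eta x k) y k) - f eta).
Proof.
rewrite /generator dsum_fin pair_big/=; apply: eq_bigr => -[x y] _ /=.
by congr (_ * _); apply: eq_bigr => k _; rewrite jump_ffun.
Qed.

(** By [weight_rate] a jump of k particles from x to y is the addition to y
    instead of x of k particles to some xi with N - k particles, with weight
    q k * W xi. Summing over x and y, the additions to y and to x cancel because
    both the rows and the columns of p have sum 1. *)
Lemma weight_stationary N (f : conf 'I_L -> R) :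
  \sum_(eta <- box L N | particles eta == N)
     weight eta * generator p g f (eta : 'I_L -> nat) = 0.
Proof.
pose D x y xi k : R := f (put_in xi y k) - f (put_in xi x k).
transitivity (\sum_x \sum_y p x y * \sum_(1 <= k < N.+1) q k *
   \sum_(eta <- box L N | (particles eta == N) && (k <= eta x)%N)
      weight (take_out eta x k) * D x y (take_out eta x k) k).
  under eq_bigr do rewrite generatorE mulr_sumr.
  rewrite exchange_big; apply: eq_bigr => x _.
  under eq_bigr do rewrite mulr_sumr.
  rewrite exchange_big; apply: eq_bigr => y _.
  under eq_bigr do rewrite mulrCA.
  rewrite -mulr_sumr; congr (_ * _).
  under [RHS]eq_bigr do rewrite mulr_sumr big_mkcondr/=.
  rewrite exchange_big; apply: eq_bigr => eta /eqP pN /=.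
  have xN : (eta x <= N)%N by rewrite -pN /particles (bigD1 x)//= leq_addr.
  rewrite [RHS](big_cat_nat (n := (eta x).+1))//=.
  rewrite [X in _ = _ + X]big_nat [X in _ = _ + X]big1 ?addr0; last first.
    by move=> k /andP[xk _]; rewrite leqNgt xk.
  rewrite mulr_sumr [LHS]big_nat [RHS]big_nat; apply: eq_bigr => k /andP[k1].
  rewrite ltnS => kx.
  by rewrite kx [LHS]mulrA weight_rate ?k1// -[LHS]mulrA /D take_outK.
under eq_bigr do under eq_bigr do under eq_bigr do
  rewrite (sum_box_take_out (fun xi => weight xi * D _ _ xi _)).
transitivity (\sum_(1 <= k < N.+1) q k *
   \sum_(xi <- box L N | (particles xi + k == N)%N)
      weight xi * \sum_x \sum_y p x y * D x y xi k).
  under eq_bigr do under eq_bigr do rewrite mulr_sumr.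
  under eq_bigr do rewrite exchange_big/=.
  rewrite exchange_big; apply: eq_bigr => k _ /=.
  under eq_bigr do under eq_bigr do rewrite mulrCA mulr_sumr.
  under eq_bigr do rewrite -mulr_sumr exchange_big/=.
  rewrite -mulr_sumr exchange_big/=; congr (_ * _); apply: eq_bigr => xi _.
  rewrite mulr_sumr; apply: eq_bigr => x _.
  by rewrite mulr_sumr; apply: eq_bigr => y _; rewrite mulrCA.
rewrite big1// => k _; rewrite big1 ?mulr0// => xi _.
suff -> : \sum_x \sum_y p x y * D x y xi k = 0 by rewrite mulr0.
rewrite /D; under eq_bigr do under eq_bigr do rewrite mulrBr.
under eq_bigr do rewrite sumrB -mulr_suml p_row mul1r.
rewrite sumrB exchange_big/=.
by under eq_bigr do rewrite -mulr_suml p_col mul1r; rewrite subrr.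
Qed.

End stationarity.

Lemma seq_argmin (R : realDomainType) (T : eqType) (h : T -> R) (s : seq T) :
  s != [::] -> exists2 x, x \in s & forall y, y \in s -> h x <= h y.
Proof.
elim: s => // x s IHs _; have [->|/IHs[y ys ymin]] := eqVneq s [::].
  by exists x => [|y]; rewrite mem_seq1// => /eqP ->.
have [xy|yx] := leP (h x) (h y).
  exists x; rewrite ?inE ?eqxx// => z /[!inE] /predU1P[->//|/ymin].
  exact: le_trans.
exists y; rewrite ?inE ?ys ?orbT// => z /[!inE] /predU1P[->|/ymin//].
exact: ltW.
Qed.

Section canonical.
Variables (R : realType) (q : nat -> R).
Hypothesis q_gt0 : forall n, 0 < q n.

Lemma partition_function_gt0 phi : 0 < phi -> (partition_function q phi < +oo)%E ->
  0 < fine (partition_function q phi).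
Proof.
move=> phi0 fin.
have t0 n : (0 <= (phi ^+ n * q n)%:E)%E.
  by rewrite lee_fin mulr_ge0// ?exprn_ge0// ltW.
apply: (@lt_le_trans _ _ (q 0%N)) => //; rewrite -lee_fin fineK; last first.
  by rewrite ge0_fin_numE// nneseries_ge0.
rewrite /partition_function; apply: le_trans (nneseries_lim_ge 1 _) => //.
by rewrite big_nat1 expr0 mul1r.
Qed.

Variable L : nat.
Implicit Types (eta : {ffun 'I_L -> nat}) (N : nat).
Local Notation W := (@weight R L q).

Definition shell_weight N : R := \sum_(eta <- box L N | particles eta == N) W eta.

Lemma dsum_shell (a : {ffun 'I_L -> nat} -> R) N :
  (forall eta, particles eta <> N -> a eta = 0) ->
  asummable a /\ dsum a = \sum_(eta <- box L N | particles eta == N) a eta.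
Proof.
move=> a0; have out eta : eta \notin box L N -> a eta = 0.
  by move=> h; apply: a0 => /particles_box; rewrite (negPf h).
split; first exact: asummable_seq out.
rewrite (dsum_seq (box_uniq L N) out) (bigID (fun eta => particles eta == N))/=.
by rewrite [X in _ + X]big1 ?addr0// => eta /eqP /a0.
Qed.

(** On the configurations with N particles phi only enters through a constant
    factor. *)
Lemma product_lawE phi eta : product_law q phi eta =
  phi ^+ particles eta / fine (partition_function q phi) ^+ L * W eta.
Proof.
rewrite /product_law /one_site_law /weight !big_split/=.
by rewrite prodrXr prodr_const card_ord exprVn /particles mulrAC.
Qed.

Hypothesis L_gt0 : (0 < L)%N.

Lemma shell_weight_gt0 N : 0 < shell_weight N.
Proof.
pose eta : {ffun 'I_L -> nat} := [ffun i => if val i == 0 then N else 0%N].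
have pN : particles eta = N.
  rewrite /particles (bigD1 (Ordinal L_gt0))//= ffunE/= big1 ?addn0// => i.
  by rewrite ffunE -val_eqE/= => /negPf ->.
rewrite /shell_weight big_mkcond (bigD1_seq eta)/= ?box_uniq ?particles_box//.
rewrite pN eqxx ltr_pwDl ?weight_gt0// sumr_ge0// => zeta _.
by case: ifP => // _; rewrite ltW// weight_gt0.
Qed.

Lemma canonical_lawE phi N eta :
  0 < phi -> (partition_function q phi < +oo)%E ->
  canonical_law q phi N eta =
  if particles eta == N then W eta / shell_weight N else 0.
Proof.
move=> phi0 fin; have Z0 := partition_function_gt0 phi0 fin.
rewrite /canonical_law; case: eqP => // pN.
have [|_ ->] := @dsum_shell (fun zeta =>
    (particles zeta == N)%:R * product_law q phi zeta) N.
  by move=> zeta /eqP/negPf ->; rewrite mul0r.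
have -> : \sum_(zeta <- box L N | particles zeta == N)
    (particles zeta == N)%:R * product_law q phi zeta =
    phi ^+ N / fine (partition_function q phi) ^+ L * shell_weight N.
  rewrite /shell_weight mulr_sumr; apply: eq_bigr => zeta /eqP pz.
  by rewrite pz eqxx mul1r product_lawE pz.
rewrite product_lawE pN; field.
by rewrite !gt_eqF ?exprn_gt0 ?shell_weight_gt0.
Qed.

End canonical.

Section uniqueness.
Variables (R : realType) (L : nat) (q : nat -> R) (g : nat -> nat -> R).
Hypothesis L_gt0 : (0 < L)%N.
Hypothesis q_gt0 : forall n, 0 < q n.
Hypothesis gE : forall k a, (1 <= k <= a)%N -> g k a = q (a - k)%N * q k / q a.
Variable p : 'I_L -> 'I_L -> R.
Hypothesis p_prob : transition_probability p.
Hypothesis p_irr : irreducible p.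
Hypothesis p_col : forall y, \sum_(x < L) p x y = 1.
Implicit Types (eta xi zeta : {ffun 'I_L -> nat}) (x y : 'I_L) (k N : nat).
Local Notation W := (@weight R L q).

Definition hop eta x y := put_in (take_out eta x 1) y 1.

Lemma hop_trans eta x z y : (0 < eta x)%N -> hop (hop eta x z) z y = hop eta x y.
Proof. by move=> ex; rewrite /hop put_inK. Qed.

(** Test the stationarity of d against the indicator of a zero zeta of d: all
    terms are nonnegative, so that d vanishes at every configuration from which
    a jump leads to zeta. Moving single particles along paths of positive p,
    every configuration leads to zeta0. *)
Lemma stationary_vanishes N (d : {ffun 'I_L -> nat} -> R) zeta0 :
  (forall eta, particles eta = N -> 0 <= d eta) ->
  (forall f : conf 'I_L -> R, \sum_(eta <- box L N | particles eta == N)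
     d eta * generator p g f (eta : 'I_L -> nat) = 0) ->
  particles zeta0 = N -> d zeta0 = 0 ->
  forall eta, particles eta = N -> d eta = 0.
Proof.
move=> d_ge0 stat pz0 dz0.
have [p_ge0 _] := p_prob.
have g_gt0 k a : (1 <= k <= a)%N -> 0 < g k a.
  by move=> h; rewrite gE// divr_gt0// mulr_gt0.
have pred eta x y : particles eta = N -> (0 < eta x)%N -> 0 < p x y ->
    d (hop eta x y) = 0 -> d eta = 0.
  move=> pN ex pxy dz; set zeta := hop eta x y in dz.
  have [->//|ez] := eqVneq eta zeta.
  pose f : conf 'I_L -> R := fun u => `[< forall i, u i = zeta i >]%:R.
  have fE (xi : {ffun 'I_L -> nat}) : f (xi : 'I_L -> nat) = (xi == zeta)%:R.
    by rewrite /f; congr (nat_of_bool _)%:R; apply/asboolP/eqP => [/ffunP|->].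
  have term_ge0 xi x' y' k : xi != zeta -> (k <= xi x')%N -> (0 < k)%N ->
      0 <= g k (xi x') * (f (put_in (take_out xi x' k) y' k) - f xi).
    move=> xz kx k0; rewrite !fE (negPf xz) subr0 mulr_ge0//.
    by rewrite ltW// g_gt0// k0.
  have gen_ge0 xi : xi != zeta -> 0 <= generator p g f (xi : 'I_L -> nat).
    move=> xz; rewrite generatorE sumr_ge0// => x' _; rewrite sumr_ge0// => y' _.
    rewrite mulr_ge0// big_nat sumr_ge0// => k /andP[k1 kx].
    exact: term_ge0.
  have all_ge0 xi : particles xi = N ->
      0 <= d xi * generator p g f (xi : 'I_L -> nat).
    have [->|xz] := eqVneq xi zeta; first by rewrite dz mul0r.
    by move=> pxi; rewrite mulr_ge0 ?d_ge0 ?gen_ge0.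
  have gen_gt0 : 0 < generator p g f (eta : 'I_L -> nat).
    rewrite generatorE (bigD1 x)//= ltr_pwDl//; last first.
      rewrite sumr_ge0// => x' _; rewrite sumr_ge0// => y' _.
      rewrite mulr_ge0// big_nat sumr_ge0// => k /andP[k1 kx].
      exact: term_ge0.
    rewrite (bigD1 y)//= ltr_pwDl//; last first.
      rewrite sumr_ge0// => y' _.
      rewrite mulr_ge0// big_nat sumr_ge0// => k /andP[k1 kx].
      exact: term_ge0.
    rewrite mulr_gt0// big_ltn ?ltnS// ltr_pwDl//; last first.
      rewrite big_nat sumr_ge0// => k /andP[k1 kx].
      by apply: term_ge0 => //; exact: leq_trans k1.
    by rewrite !fE -/(hop eta x y) -/zeta eqxx (negPf ez) subr0 mulr1 g_gt0.
  have := stat f; rewrite big_mkcond (bigD1_seq eta)/= ?box_uniq ?particles_box//.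
  rewrite pN eqxx => /eqP; rewrite paddr_eq0 ?all_ge0//; last first.
    by apply: sumr_ge0 => xi _; case: eqP => // /all_ge0.
  by rewrite mulf_eq0 (gt_eqF gen_gt0) orbF => /andP[/eqP].
have along s : forall eta x, path (fun u v => 0 < p u v) x s ->
    particles eta = N -> (0 < eta x)%N -> d (hop eta x (last x s)) = 0 -> d eta = 0.
  elim: s => [|z s IHs] eta x /=.
    by move=> _ pN ex; rewrite /hop take_outK.
  move=> /andP[pxz pth] pN ex dlast; apply: (pred _ _ _ pN ex pxz).
  apply: (IHs _ z pth); last by rewrite hop_trans.
    by rewrite particles_jump.
  exact: put_in_ge.
(* number of particles that have to be moved to reach zeta0 *)
pose excess eta := (\sum_i (eta i - zeta0 i))%N.
move=> eta; move: {2}(excess eta) (leqnn (excess eta)) => n.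
elim: n eta => [|n IHn] eta le_n pN.
  have le_z i : (eta i <= zeta0 i)%N.
    move: le_n; rewrite leqn0 sum_nat_eq0 => /forallP/(_ i).
    by rewrite subn_eq0.
  suff -> : eta = zeta0 by [].
  apply/ffunP => i; apply/eqP; rewrite eqn_leq le_z/= leqNgt; apply/negP => lt_i.
  have : (particles eta < particles zeta0)%N.
    rewrite /particles (bigD1 i)//= [ltnRHS](bigD1 i)//= -addSn leq_add//.
    by apply: leq_sum => j _.
  by rewrite pN pz0 ltnn.
have [/existsP[x lt_x]|/existsPn no_x] := boolP [exists x, (zeta0 x < eta x)%N].
  have [/existsP[y lt_y]|/existsPn no_y] := boolP [exists y, (eta y < zeta0 y)%N].
    have ex : (0 < eta x)%N by apply: leq_ltn_trans lt_x.
    have [s [pth las]] := p_irr x y.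
    apply: (along s eta x pth pN ex); rewrite las; apply: IHn; last first.
      by rewrite particles_jump.
    rewrite -ltnS (leq_trans _ le_n)// /excess.
    rewrite (bigD1 x)//= [ltnRHS](bigD1 x)//= -addSn leq_add//.
      rewrite !ffunE eqxx mul1n; case: (eqVneq x y) lt_y => [<-|_ _].
        by move/ltnW; rewrite leqNgt lt_x.
      by rewrite mul0n addn0; lia.
    apply: leq_sum => j jx; rewrite !ffunE (negPf jx) mul0n subn0.
    by case: eqVneq => [->|_]; [lia|rewrite mul0n addn0].
  have : (particles zeta0 < particles eta)%N.
    rewrite /particles (bigD1 x)//= [ltnRHS](bigD1 x)//= -addSn leq_add//.
    by apply: leq_sum => j _; rewrite leqNgt.
  by rewrite pN pz0 ltnn.
apply: IHn => //; rewrite /excess big1// => i _.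
by apply/eqP; rewrite subn_eq0 leqNgt.
Qed.

(** Subtract from a stationary m the largest multiple of W that stays below m:
    the difference vanishes somewhere, hence everywhere. *)
Lemma stationary_lawP (N : nat) phi (m : {ffun 'I_L -> nat} -> R) :
  0 < phi -> (partition_function q phi < +oo)%E ->
  stationary_law N p g m <-> m =1 canonical_law q phi N.
Proof.
move=> phi0 fin.
have canE eta := canonical_lawE q_gt0 L_gt0 N eta phi0 fin.
have Z0 := shell_weight_gt0 q_gt0 L_gt0 N.
split; last first.
  move=> mE; split.
  - move=> eta; rewrite mE canE; case: ifP => // _.
    by rewrite divr_ge0// ltW// weight_gt0.
  - by move=> eta /eqP pN; rewrite mE canE (negPf pN).
  - have [|_ ->] := @dsum_shell R L m N.
      by move=> eta /eqP pN; rewrite mE canE (negPf pN).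
    under eq_bigr => eta pN do rewrite mE canE pN.
    by rewrite -mulr_suml divff// gt_eqF.
  - move=> f.
    have [|_ ->] := @dsum_shell R L (fun eta => m eta * generator p g f (eta : 'I_L -> nat)) N.
      by move=> eta /eqP pN; rewrite mE canE (negPf pN) mul0r.
    under eq_bigr => eta pN do rewrite mE canE pN mulrAC.
    by rewrite -mulr_suml (weight_stationary q_gt0 gE p_prob p_col) mul0r.
move=> [m0 mN m1 mstat] eta; rewrite canE.
case: eqP => [pN|/mN//].
(* c is the minimum of m / W, attained at zeta0 *)
have [c [zeta0 [pz cz cmin]]] : exists c zeta0, [/\ particles zeta0 = N,
    m zeta0 = c * W zeta0 & forall eta, particles eta = N -> c * W eta <= m eta].
  pose s := [seq xi <- box L N | particles xi == N].
  have es : eta \in s by rewrite mem_filter pN eqxx/= particles_box.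
  have s0 : s != [::] by apply: contraTneq es => ->.
  have [zeta0 + zmin] := seq_argmin (fun xi => m xi / W xi) s0.
  rewrite mem_filter => /andP[/eqP pz _].
  exists (m zeta0 / W zeta0), zeta0; split => //.
    by rewrite divfK// gt_eqF// weight_gt0.
  move=> xi pxi; rewrite -ler_pdivlMr ?weight_gt0//; apply: zmin.
  by rewrite mem_filter pxi eqxx/= particles_box.
have vanish : forall eta, particles eta = N -> m eta - c * W eta = 0.
  apply: (@stationary_vanishes N (fun eta => m eta - c * W eta) zeta0) => //.
  - by move=> xi /cmin; rewrite subr_ge0.
  - move=> f; under eq_bigr do rewrite mulrBl -mulrA.
    rewrite sumrB -mulr_sumr (weight_stationary q_gt0 gE p_prob p_col) mulr0 subr0.
    rewrite -[RHS](mstat f).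
    have [|_ ->//] := @dsum_shell R L (fun eta => m eta * generator p g f (eta : 'I_L -> nat)) N.
    by move=> xi /mN ->; rewrite mul0r.
  - by rewrite cz subrr.
have mE xi : particles xi = N -> m xi = c * W xi.
  by move=> /vanish /eqP; rewrite subr_eq0 => /eqP.
have cZ : c * shell_weight q L N = 1.
  rewrite -m1; have [_ ->] := dsum_shell mN.
  by rewrite /shell_weight mulr_sumr; apply: eq_bigr => xi /eqP /mE.
by rewrite mE// -[c](mulfK (lt0r_neq0 Z0)) cZ mul1r mulrC.
Qed.

End uniqueness.

(** * The critical partition function *)

Section partition_function.
Variables (R : realType) (w : nat -> R).
Hypothesis (w_gt0 : forall n, 0 < w n).
Let b : R := 3 / 2.
Let b_gt0 : 0 < b. Proof. by rewrite /b; lra. Qed.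
Let q := pi_b b w.
Let q_gt0 n : 0 < q n. Proof. exact: pi_b_gt0. Qed.

Let q_ge0 n : 0 <= q n. Proof. exact: ltW. Qed.

Let qS n : (n.+1%:R + 3 / 2) * q n.+2 = n.+1%:R * q n.+1.
Proof. exact: (pi_bS w b_gt0). Qed.

(** Telescoping: for b = 3/2, q n = (2n + 1) q n - (2n + 3) q (n+1)
    for n >= 1. *)
Lemma pi_b_partial_sum n :
  \sum_(0 <= k < n.+1) q k + (2 * n.+1%:R + 1) * q n.+1 = q 0 + 3 * q 1.
Proof.
elim: n => [|n IHn]; first by rewrite big_nat1; lra.
rewrite -IHn big_nat_recr//= -!addrA; congr (_ + _).
have := qS n; rewrite -[n.+2%:R]natr1; lra.
Qed.

Lemma partition_function1_lt : (partition_function q 1 < +oo)%E.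
Proof.
apply: (@le_lt_trans _ _ (q 0 + 3 * q 1)%:E); last exact: ltry.
have t0 n : (0 <= (1 ^+ n * q n)%:E)%E by rewrite lee_fin expr1n mul1r ltW.
have B n : (\sum_(0 <= k < n) (1 ^+ k * q k)%:E <= (q 0 + 3 * q 1)%:E)%E.
  rewrite sumEFin lee_fin; case: n => [|n].
    by rewrite big_geq// addr_ge0 ?q_ge0// mulr_ge0 ?q_ge0.
  rewrite -(pi_b_partial_sum n); under eq_bigr do rewrite expr1n mul1r.
  by rewrite lerDl mulr_ge0 ?q_ge0// addr_ge0// mulr_ge0.
by apply: lime_le; [exact: is_cvg_nneseries|exact: nearW B].
Qed.

(** The terms of the series are eventually nondecreasing, and positive. *)
Lemma partition_function_gt1 phi : 1 < phi -> partition_function q phi = +oo%E.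
Proof.
move=> phi1; apply/eqP; rewrite -leye_eq leNgt; apply/negP => fin.
have phi0 : 0 < phi by apply: lt_trans phi1.
have t0 n : 0 < phi ^+ n * q n by rewrite mulr_gt0// exprn_gt0.
have [n0 hn0] : exists n0, forall n, (n0 <= n)%N ->
    phi ^+ n.+1 * q n.+1 <= phi ^+ n.+2 * q n.+2.
  have dphi : 0 < phi - 1 by lra.
  (* phi n >= n + 3/2 from here on *)
  exists (Num.truncn (3 / 2 / (phi - 1))).+1 => n nn0.
  have : 3 / 2 <= n.+1%:R * (phi - 1).
    rewrite -ler_pdivrMr//; apply: le_trans (ltW (truncnS_gt _)) _.
    by rewrite ler_nat (leq_trans nn0).
  move=> hn; rewrite (exprSr _ n.+1) -mulrA ler_pM2l ?exprn_gt0//.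
  have n1 : 0 < n.+1%:R + 3 / 2 :> R by rewrite ltr_wpDl//; lra.
  rewrite -(ler_pM2l n1) [leRHS]mulrCA qS [leRHS]mulrA ler_pM2r//.
  by move: hn; rewrite mulrBr mulr1 mulrC; lra.
have mono n m : (n0 < n)%N -> phi ^+ n * q n <= phi ^+ (n + m) * q (n + m).
  move=> nn; elim: m => [|m IHm]; first by rewrite addn0.
  apply: le_trans IHm _; rewrite addnS; case: n nn => // n nn.
  by rewrite addSn; apply: hn0; rewrite (leq_trans _ (leq_addr _ _)).
pose c := phi ^+ n0.+1 * q n0.+1.
have c0 : 0 < c := t0 n0.+1.
pose K := fine (partition_function q phi).
have KE : partition_function q phi = K%:E.
  by rewrite fineK// ge0_fin_numE// nneseries_ge0// => n _ _; rewrite lee_fin ltW.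
have lower m : m%:R * c <= K.
  rewrite -lee_fin -KE; apply: le_trans (nneseries_lim_ge (n0.+1 + m) _); last first.
    by move=> n _ _; rewrite lee_fin ltW.
  rewrite sumEFin lee_fin (big_cat_nat (n := n0.+1))//= ?leq_addr//.
  rewrite ler_wpDl//; first by apply: sumr_ge0 => n _; rewrite ltW.
  rewrite -{1}[n0.+1]add0n big_addn addnC addnK.
  rewrite mulr_natl -[in leLHS](subn0 m) -[leLHS]sumr_const_nat.
  by apply: ler_sum => k _; rewrite addnC; apply: mono.
have := lower (Num.truncn (K / c)).+1.
by rewrite leNgt -ltr_pdivrMr// truncnS_gt.
Qed.

Lemma phi_c_pi_b : phi_c q = 1%E.
Proof.
apply/eqP; rewrite eq_le; apply/andP; split.
  apply: ge_ereal_sup => _ [phi [phi0 fin] <-]; rewrite lee_fin leNgt.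
  by apply/negP => /partition_function_gt1 E; rewrite E in fin.
apply: ereal_sup_ubound; exists 1 => //; split => //.
exact: partition_function1_lt.
Qed.

Lemma pi_b_summable : asummable q /\ dsum q = fine (partition_function q 1).
Proof.
have q0 n : 0 <= q n by rewrite ltW.
have E : partition_function q 1 = (\esum_(n in [set: nat]) (q n)%:E)%E.
  rewrite /partition_function nneseries_esumT; last first.
    by move=> n; rewrite lee_fin expr1n mul1r.
  by apply: eq_esum => n _; rewrite expr1n mul1r.
split; last by rewrite dsum_ge0E// E.
apply/asummableE; under eq_esum do rewrite ger0_norm//.
by rewrite -E; exact: partition_function1_lt.
Qed.

(** n^2 q n is nondecreasing because (n+1)^2 >= n (n + b) for b <= 2. *)
Lemma pi_b_sq n : (0 < n)%N -> n%:R ^+ 2 * q n <= n.+1%:R ^+ 2 * q n.+1.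
Proof.
case: n => // n _; have n1 : 0 < n.+1%:R + 3 / 2 :> R by rewrite ltr_wpDl//; lra.
rewrite -(ler_pM2l n1) [leRHS]mulrCA qS [leLHS]mulrA [leRHS]mulrA ler_pM2r//.
have : 0 <= n.+1%:R :> R by [].
by rewrite -[n.+2%:R]natr1 !expr2; nra.
Qed.

(** By [pi_b_sq] q m / q N is at most (N / m)^2. *)
Lemma pi_b_comparable L m N : (m <= N)%N -> (N <= L * m)%N -> (0 < L)%N ->
  q m <= L%:R ^+ 2 * q N.
Proof.
move=> mN NLm L0; case: (posnP m) => [m0|m0].
  rewrite m0 muln0 leqn0 in NLm; rewrite m0 (eqP NLm) ler_peMl ?(ltW (q_gt0 _))//.
  by rewrite exprn_ege1// ler1n.
have sq : m%:R ^+ 2 * q m <= N%:R ^+ 2 * q N.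
  rewrite -(subnKC mN); elim: (N - m)%N => [|k IHk]; first by rewrite addn0.
  by apply: le_trans IHk _; rewrite addnS; apply: pi_b_sq; rewrite addn_gt0 m0.
have m2 : 0 < m%:R ^+ 2 :> R by rewrite exprn_gt0// ltr0n.
rewrite -(ler_pM2l m2); apply: le_trans sq _.
rewrite mulrA ler_wpM2r ?(ltW (q_gt0 _))// -exprMn lerXn2r ?nnegrE ?mulr_ge0//.
by rewrite -natrM ler_nat mulnC.
Qed.

Lemma pi_b_long_tail j : (fun N => q (N - j) / q N) @ \oo --> (1 : R).
Proof.
rewrite -(cvg_shiftn j)/=.
have -> : (fun n => q (n + j - j)%N / q (n + j)) = (fun n => q n / q (n + j)).
  by apply/funext => n; rewrite addnK.
elim: j => [|j IHj].
  rewrite (_ : (fun n => _) = cst 1); first exact: cvg_cst.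
  by apply/funext => n; rewrite addn0 divff// gt_eqF.
have step : (fun n => q n / q n.+1) @ \oo --> (1 : R).
  rewrite -(cvg_shiftn 1)/=.
  have -> : (fun n => q (n + 1)%N / q (n + 1).+1) =
      (fun n : nat => 1 + 3 / 2 * n.+1%:R^-1).
    apply/funext => n; rewrite addn1; have n1 : 0 < n.+1%:R :> R by rewrite ltr0n.
    apply: (mulIf (lt0r_neq0 (q_gt0 n.+2))); rewrite divfK ?gt_eqF//.
    apply: (mulfI (lt0r_neq0 n1)); rewrite -qS.
    by move: n1; move: (n.+1%:R : R) => x x0; field; rewrite gt_eqF.
  have : (fun n : nat => 1 + 3 / 2 * n.+1%:R^-1) @ \oo --> (1 + 3 / 2 * 0 : R).
    by apply: cvgD; [exact: cvg_cst|apply: cvgMr; exact: cvg_harmonic].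
  by rewrite mulr0 addr0.
have -> : (fun n => q n / q (n + j.+1)) =
    (fun n => q n / q (n + j) * (q (n + j) / q (n + j).+1)).
  by apply/funext => n; rewrite addnS mulrA divfK ?gt_eqF.
have : (fun n => q n / q (n + j) * (q (n + j) / q (n + j).+1)) @ \oo -->
    (1 * 1 : R).
  by apply: cvgM => //; rewrite (cvg_shiftn j (fun n => q n / q n.+1)).
by rewrite mulr1.
Qed.

End partition_function.

(** * Sums over configurations and the largest coordinate *)

Section weight_sum.
Variables (R : realType) (q : nat -> R).
Hypothesis q_gt0 : forall n, 0 < q n.
Hypothesis q_sum : asummable q.
Variable n : nat.

Lemma weight_box_sum M :
  \sum_(xi <- box n M) weight q xi = (\sum_(0 <= k < M.+1) q k) ^+ n.
Proof.
rewrite big_mkord -[in RHS](card_ord n) -prodr_const bigA_distr_bigA/=.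
rewrite /box big_image/=; apply: eq_bigr => e _.
by apply: eq_bigr => i _; rewrite ffunE.
Qed.

Lemma partial_sum_cvg : (fun M => \sum_(0 <= k < M) q k) @ \oo --> dsum q.
Proof.
have -> : (fun M => \sum_(0 <= k < M) q k) =
    (fun M => dsum (fun k => if (k < M)%N then q k else 0)).
  apply/funext => M; rewrite (dsum_seq (iota_uniq 0 M)).
    by rewrite /index_iota subn0 !big_seq; apply: eq_bigr => k; rewrite mem_iota/= add0n => ->.
  by move=> k; rewrite mem_iota/= add0n => /negPf ->.
apply: (dsum_dominated_cvg q_sum) => [M k|k].
  by case: ifP; rewrite ?normr0 ?gtr0_norm// ltW.
apply: cvg_near_cst; exists k.+1 => // M /= kM.
by rewrite kM.
Qed.

(** The sums over boxes are powers of partial sums of q, and every finite set of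
    configurations is contained in a box. *)
Lemma weight_sum : asummable (@weight R n q) /\ dsum (@weight R n q) = dsum q ^+ n.
Proof.
have W0 (xi : {ffun 'I_n -> nat}) : 0 <= weight q xi by rewrite ltW// weight_gt0.
have q0 k : 0 <= q k by rewrite ltW.
have part M : \sum_(0 <= k < M.+1) q k <= dsum q by rewrite ler_sum_dsum ?iota_uniq.
have bound (s : seq {ffun 'I_n -> nat}) : uniq s -> \sum_(xi <- s) weight q xi <= dsum q ^+ n.
  move=> us; pose M := (\sum_(xi <- s) particles xi)%N.
  apply: (@le_trans _ _ (\sum_(xi <- box n M) weight q xi)); last first.
    by rewrite weight_box_sum lerXn2r ?nnegrE ?dsum_ge0 ?sumr_ge0.
  have sub : {subset s <= box n M}.
    move=> xi xs; rewrite mem_box; apply/forallP => i.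
    rewrite /M (bigD1_seq xi)//= (leq_trans _ (leq_addr _ _))//.
    by rewrite /particles (bigD1 i)//= leq_addr.
  rewrite [leRHS](bigID (mem s))/= -[X in _ <= X + _]big_filter.
  rewrite [X in _ <= X + _](perm_big s)/=; first by rewrite lerDl sumr_ge0.
  apply: uniq_perm; rewrite ?filter_uniq ?box_uniq// => xi.
  by rewrite mem_filter/=; case: (boolP (xi \in s)) => //= /sub.
have sW : asummable (@weight R n q).
  apply: (@asummable_bound _ _ _ (dsum q ^+ n)) => s us.
  by under eq_bigr do rewrite ger0_norm//; apply: bound.
split => //; apply/eqP; rewrite eq_le dsum_le_bound//=.
have cv : (fun M => (\sum_(0 <= k < M.+1) q k) ^+ n) @ \oo --> dsum q ^+ n.
  apply: (@cvg_comp _ _ _ (fun M => \sum_(0 <= k < M.+1) q k) (fun x => x ^+ n) _ (nbhs (dsum q))).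
    rewrite (cvg_shiftS (fun M => \sum_(0 <= k < M) q k)).
    exact: partial_sum_cvg.
  exact: exprn_continuous.
rewrite -(cvg_lim (@Rhausdorff R) cv).
apply: limr_le; first by apply/cvg_ex; eexists; exact: cv.
by apply: nearW => M; rewrite -weight_box_sum ler_sum_dsum ?box_uniq.
Qed.

End weight_sum.

Section largest_coordinate.
Variable n : nat.
Implicit Types (eta : {ffun 'I_n.+1 -> nat}) (xi : {ffun 'I_n -> nat}).
Implicit Types (i j : 'I_n.+1) (m N : nat).

Definition insert_site i xi m : {ffun 'I_n.+1 -> nat} :=
  [ffun j => if unlift i j is Some k then xi k else m].
Definition remove_site i eta : {ffun 'I_n -> nat} := [ffun k => eta (lift i k)].

Lemma insert_site_at i xi m : insert_site i xi m i = m.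
Proof. by rewrite ffunE unlift_none. Qed.

Lemma insert_site_lift i xi m k : insert_site i xi m (lift i k) = xi k.
Proof. by rewrite ffunE liftK. Qed.

Lemma insert_siteK i xi m : remove_site i (insert_site i xi m) = xi.
Proof. by apply/ffunP => k; rewrite ffunE insert_site_lift. Qed.

Lemma remove_siteK i eta : insert_site i (remove_site i eta) (eta i) = eta.
Proof.
by apply/ffunP => j; rewrite ffunE; case: unliftP => [k ->|->]; rewrite ?ffunE.
Qed.

Lemma particles_site i eta : particles eta = (eta i + particles (remove_site i eta))%N.
Proof.
rewrite /particles (bigD1_ord i)//=; congr (_ + _)%N.
by apply: eq_bigr => k _; rewrite ffunE.
Qed.

Lemma weight_site (R : realType) (q : nat -> R) i eta :
  weight q eta = q (eta i) * weight q (remove_site i eta).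
Proof.
rewrite /weight (bigD1_ord i)//=; congr (_ * _).
by apply: eq_bigr => k _; rewrite ffunE.
Qed.

(** A position of the maximum; among several of them an arbitrary one is chosen,
    which makes the positions a partition of the configurations. *)
Definition largest eta : 'I_n.+1 := [arg max_(i > ord0) eta i].

Lemma largestP eta j : (eta j <= eta (largest eta))%N.
Proof. by rewrite /largest; case: arg_maxnP => // i _; apply. Qed.

Lemma lowest_remove eta :
  lowest n eta = lowest n (remove_site (largest eta) eta).
Proof.
set i := largest eta; pose xi := remove_site i eta.
suff E : sort leq (codom eta) = rcons (sort leq (codom xi)) (eta i).
  apply/ffunP => k; rewrite !ffunE E nth_rcons size_sort size_codom card_ord.
  by rewrite ltn_ord.
have xi_le x : x \in codom xi -> (x <= eta i)%N.
  by move=> /codomP[k ->]; rewrite ffunE largestP.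
apply: (@sorted_eq _ leq leq_trans anti_leq).
- exact/sort_sorted/leq_total.
- have := sort_sorted leq_total (codom xi).
  have : all (fun x => x <= eta i)%N (sort leq (codom xi)).
    by apply/seq.allP => x; rewrite mem_sort; exact: xi_le.
  case: (sort leq (codom xi)) => // x r /seq.allP le_r /= pr.
  (* the largest coordinate may be appended to the sorted list of the others *)
  by rewrite rcons_path pr/= le_r// mem_last.
rewrite perm_sort perm_sym perm_rcons.
have perm_enum : perm_eq (enum 'I_n.+1) (i :: map (lift i) (enum 'I_n)).
  apply: uniq_perm; first exact: enum_uniq.
    rewrite /= map_inj_uniq ?enum_uniq ?andbT//; last exact: lift_inj.
    by apply/mapP => -[k _ /eqP]; rewrite (negPf (neq_lift i k)).
  move=> j; rewrite mem_enum in_cons; apply/esym.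
  case: (unliftP i j) => [k ->|->]; last by rewrite eqxx.
  by rewrite map_f ?orbT// mem_enum.
have -> : codom xi = [seq eta j | j <- map (lift i) (enum 'I_n)].
  by rewrite -map_comp; apply: eq_map => k; rewrite /= ffunE.
rewrite perm_sym; apply: (perm_trans (perm_map eta perm_enum)).
by rewrite /= perm_cons perm_sym perm_sort.
Qed.

(** A configuration with N particles is determined by the position of its largest
    coordinate and by its other coordinates. *)
Lemma sum_by_largest (R : realType) (a : {ffun 'I_n.+1 -> nat} -> R) N :
  \sum_(eta <- box n.+1 N | particles eta == N) a eta =
  \sum_(i < n.+1) dsum (fun xi : {ffun 'I_n -> nat} =>
    let eta := insert_site i xi (N - particles xi) in
    if (particles xi <= N)%N && (largest eta == i) then a eta else 0).
Proof.
transitivity (\sum_(i < n.+1)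
    \sum_(eta <- box n.+1 N | (particles eta == N) && (largest eta == i)) a eta).
  under [RHS]eq_bigr do rewrite big_mkcondr/=.
  rewrite exchange_big; apply: eq_bigr => eta _ /=.
  by rewrite -big_mkcond (big_pred1 (largest eta))// => i; rewrite eq_sym.
apply: eq_bigr => i _; rewrite -big_filter.
set s := [seq _ <- _ | _].
have sE eta : (eta \in s) = (particles eta == N) && (largest eta == i).
  rewrite mem_filter andbC; case: eqP => /=; last by rewrite andbF.
  by move=> pN; rewrite particles_box.
have back eta : eta \in s ->
    insert_site i (remove_site i eta) (N - particles (remove_site i eta)) = eta.
  rewrite sE => /andP[/eqP <- _]; rewrite (particles_site i) addnK.
  exact: remove_siteK.
rewrite (dsum_seq (s := [seq remove_site i eta | eta <- s])).
- rewrite big_map [LHS]big_seq [RHS]big_seq; apply: eq_bigr => eta es.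
  rewrite /= back//; move: es; rewrite sE => /andP[/eqP pN ->].
  by rewrite -pN (particles_site i) leq_addl.
- rewrite map_inj_in_uniq; first by rewrite filter_uniq// box_uniq.
  move=> e e' es e's ee.
  by rewrite -(back e es) -(back e' e's) ee.
- move=> xi xis /=; case: ifP => // /andP[pN li]; case/negP: xis.
  apply/mapP; exists (insert_site i xi (N - particles xi)); last by rewrite insert_siteK.
  by rewrite sE li (particles_site i) insert_site_at insert_siteK subnK// eqxx.
Qed.

End largest_coordinate.

(** * The lowest coordinates as the number of particles grows *)

Section fixed_volume.
Variables (R : realType) (w : nat -> R).
Hypothesis (w_gt0 : forall n, 0 < w n).
Let b : R := 3 / 2.
Let b_gt0 : 0 < b. Proof. by rewrite /b; lra. Qed.
Let q := pi_b b w.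
Let q_gt0 n : 0 < q n. Proof. exact: pi_b_gt0. Qed.
Variable n : nat.

Lemma largest_insert_site (i : 'I_n.+1) (xi : {ffun 'I_n -> nat}) m :
  (particles xi < m)%N -> largest (insert_site i xi m) = i.
Proof.
move=> lt_m; have := largestP (insert_site i xi m) i; rewrite insert_site_at.
case: (unliftP i (largest (insert_site i xi m))) => // k ->.
rewrite insert_site_lift => le_m.
have : (xi k <= particles xi)%N by rewrite /particles (bigD1 k)//= leq_addr.
by move=> le_k; have := leq_trans lt_m (leq_trans le_m le_k); rewrite ltnn.
Qed.

(** In [sum_by_largest] the largest coordinate N - |xi| is at least N / (n+1), so
    that by [pi_b_comparable] the ratio q (N - |xi|) / q N is at most (n+1)^2;
    it tends to 1, and for N > 2 |xi| the added coordinate is the largest one. *)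
Lemma shell_sum_cvg (f : {ffun 'I_n -> nat} -> R) (M : R) :
  (forall xi, `|f xi| <= M) ->
  (fun N => (\sum_(eta <- box n.+1 N | particles eta == N)
     weight q eta * f (lowest n eta)) / q N) @ \oo -->
  n.+1%:R * dsum (fun xi : {ffun 'I_n -> nat} => weight q xi * f (lowest n xi)).
Proof.
move=> fM; have [q_sum _] := pi_b_summable w_gt0.
have [sW _] := weight_sum q_gt0 q_sum n.
have M0 : 0 <= M := le_trans (normr_ge0 _) (fM [ffun=> 0%N]).
pose term i N (xi : {ffun 'I_n -> nat}) : R :=
  if (particles xi <= N)%N && (largest (insert_site i xi (N - particles xi)) == i)
  then q (N - particles xi)%N / q N * (weight q xi * f (lowest n xi)) else 0.
have -> : (fun N => (\sum_(eta <- box n.+1 N | particles eta == N)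
     weight q eta * f (lowest n eta)) / q N) =
    (fun N => \sum_(i < n.+1) dsum (term i N)).
  apply/funext => N; rewrite mulr_suml sum_by_largest; apply: eq_bigr => i _.
  apply: eq_dsum => xi /=; rewrite /term; case: ifP => // /andP[_ /eqP li].
  rewrite lowest_remove li insert_siteK (weight_site q i) insert_site_at insert_siteK.
  by rewrite -!mulrA [RHS]mulrCA !mulrA [in RHS]mulrAC; ring.
have -> : n.+1%:R * dsum (fun xi : {ffun 'I_n -> nat} => weight q xi * f (lowest n xi)) =
    \sum_(i < n.+1) dsum (fun xi : {ffun 'I_n -> nat} => weight q xi * f (lowest n xi)).
  by rewrite sumr_const card_ord mulr_natl.
apply: cvg_big => [|i _]; first exact: add_continuous.
apply: (dsum_dominated_cvg (g := fun xi => n.+1%:R ^+ 2 * M * weight q xi)).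
- exact: asummableZ.
- move=> N xi; have W0 : 0 < weight q xi by exact: weight_gt0.
  have c0 : 0 <= n.+1%:R ^+ 2 :> R by rewrite exprn_ge0.
  rewrite /term; case: ifP => [/andP[le_N /eqP li]|_]; last first.
    by rewrite normr0 !mulr_ge0// ltW.
  rewrite normrM [`|weight q xi * _|]normrM (gtr0_norm W0).
  rewrite gtr0_norm ?divr_gt0// -[leRHS]mulrA; apply: ler_pM.
  + by rewrite divr_ge0// ltW.
  + by rewrite mulr_ge0// ltW.
  + rewrite ler_pdivrMr//; apply: (pi_b_comparable w_gt0) => //; first exact: leq_subr.
    set eta := insert_site i xi (N - particles xi) in li.
    have pN : particles eta = N.
      by rewrite (particles_site i) insert_site_at insert_siteK subnK.
    rewrite -[X in (X <= _)%N]pN /particles.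
    apply: (@leq_trans (\sum_(j < n.+1) eta (largest eta))).
      by apply: leq_sum => j _; exact: largestP.
    by rewrite sum_nat_const card_ord li /eta insert_site_at.
  + by rewrite mulrC ler_wpM2r// ltW.
move=> xi; set c := weight q xi * f (lowest n xi).
have : (fun N => q (N - particles xi)%N / q N * c) @ \oo --> 1 * c.
  by apply: cvgMl; exact: pi_b_long_tail.
rewrite mul1r; apply: cvg_trans; apply: near_eq_cvg.
exists (particles xi).*2.+1 => // N /= lt_N.
rewrite /term largest_insert_site ?eqxx ?andbT; last by lia.
by rewrite ifT//; lia.
Qed.

(** The expectation under the canonical law is a quotient of two sums of
    [shell_sum_cvg], the denominator being that of the constant 1. *)
Lemma lowest_weak_cvg phi : 0 < phi -> (partition_function q phi < +oo)%E ->
  weak_cvg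
    (fun N => pushforward_law (@lowest n n.+1) (canonical_law q phi N))
    (pushforward_law (@lowest n n) (product_law q 1 (L := n))).
Proof.
move=> phi0 fin f [M fM].
have [q_sum dq] := pi_b_summable w_gt0.
have [sW dW] := weight_sum q_gt0 q_sum n.
have Z0 : 0 < fine (partition_function q 1).
  by apply: partition_function_gt0 => //; exact: partition_function1_lt.
pose Z := fine (partition_function q 1) ^+ n.
have Zn0 : 0 < Z by rewrite exprn_gt0.
have M0 : 0 <= M := le_trans (normr_ge0 _) (fM [ffun=> 0%N]).
have prodE (xi : {ffun 'I_n -> nat}) : product_law q 1 xi = Z^-1 * weight q xi.
  by rewrite product_lawE expr1n mul1r.
have prod0 (xi : {ffun 'I_n -> nat}) : 0 <= product_law q 1 xi.
  by rewrite prodE mulr_ge0 ?invr_ge0 ?(ltW Zn0)// ltW// weight_gt0.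
have sprod : asummable (product_law q 1 (L := n)).
  by rewrite (funext prodE); exact: asummableZ.
have sWf : asummable (fun xi : {ffun 'I_n -> nat} => weight q xi * f (lowest n xi)).
  apply: (@asummable_le _ _ _ (fun xi => M * weight q xi)); last exact: asummableZ.
  move=> xi; rewrite normrM gtr0_norm ?weight_gt0// mulrC ler_wpM2r//.
  by rewrite ltW// weight_gt0.
have canE N eta := canonical_lawE q_gt0 (ltn0Sn n) N eta phi0 fin.
have Zs0 N : 0 < shell_weight q n.+1 N by exact: shell_weight_gt0.
rewrite (@dsum_pushforward _ _ _ (@lowest n n) _ prod0 sprod f M fM).
have -> : dsum (fun xi : {ffun 'I_n -> nat} => product_law q 1 xi * f (lowest n xi)) =
    dsum (fun xi : {ffun 'I_n -> nat} => weight q xi * f (lowest n xi)) / Z.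
  by rewrite mulrC -(dsumZ _ sWf); apply: eq_dsum => xi; rewrite prodE mulrA.
have -> : (fun N => dsum (fun xi => pushforward_law (@lowest n n.+1)
      (canonical_law q phi N) xi * f xi)) =
    (fun N => ((\sum_(eta <- box n.+1 N | particles eta == N)
       weight q eta * f (lowest n eta)) / q N) / (shell_weight q n.+1 N / q N)).
  apply/funext => N.
  have can0 (eta : {ffun 'I_n.+1 -> nat}) : 0 <= canonical_law q phi N eta.
    by rewrite canE; case: ifP => // _; rewrite divr_ge0// ltW// weight_gt0.
  have out (eta : {ffun 'I_n.+1 -> nat}) : particles eta <> N ->
      canonical_law q phi N eta = 0.
    by move/eqP/negPf; rewrite canE => ->.
  have [scan _] := dsum_shell out.
  rewrite (@dsum_pushforward _ _ _ (@lowest n n.+1) _ can0 scan f M fM).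
  have [|_ ->] := @dsum_shell R n.+1
      (fun eta => canonical_law q phi N eta * f (lowest n eta)) N.
    by move=> eta /out ->; rewrite mul0r.
  under eq_bigr => eta pN do rewrite canE pN mulrAC.
  rewrite -mulr_suml; field.
  by rewrite !gt_eqF.
have E1 : n.+1%:R * dsum (fun xi : {ffun 'I_n -> nat} => weight q xi * 1) = n.+1%:R * Z.
  by congr (_ * _); rewrite /Z -dq -dW; apply: eq_dsum => xi; rewrite mulr1.
have n1 : 0 < n.+1%:R :> R by rewrite ltr0n.
have -> : dsum (fun xi : {ffun 'I_n -> nat} => weight q xi * f (lowest n xi)) / Z =
   n.+1%:R * dsum (fun xi : {ffun 'I_n -> nat} => weight q xi * f (lowest n xi)) /
   (n.+1%:R * Z).
  by rewrite -mulf_div divff ?mul1r// gt_eqF.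
apply: cvgM; first exact: shell_sum_cvg fM.
apply: cvgV; first by rewrite gt_eqF// mulr_gt0.
rewrite -E1; have one_le (xi : {ffun 'I_n -> nat}) : `|(fun=> 1) xi : R| <= 1.
  by rewrite normr1.
have := shell_sum_cvg one_le; rewrite /shell_weight.
by under eq_fun do under eq_bigr do rewrite mulr1.
Qed.

End fixed_volume.

(** * Attractiveness and condensation for b = 3/2 *)

Theorem proposition6p3 (R : realType) (b : R) (w : nat -> R)
  (hb : b = 3 / 2)
  (w_gt0 : forall n, 0 < w n)
  (hw : (1 + b) * w 1%N <= w 0%N) :
  (forall (X : countType) (p : X -> X -> R)
     (S : set (conf X)) (P : R -> conf X -> probability (bconf X) R),
     transition_probability p -> irreducible p ->
     mm_zrp p (mm_rate b w) S P -> attractive S P) /\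
  condensation_fixed_volume (mm_rate b w) (pi_b b w).
Proof.
have b0 : 0 < b by rewrite hb; lra.
have q0 := pi_b_gt0 b0 w_gt0; have gE := mm_rateE b0 w_gt0.
split.
  move=> X p S P p_prob _ mm; apply: (attractive_of_tails p_prob _ _ _ mm).
  - exact: mm_rate_ge0.
  - by rewrite hb; exact: mm_rate_tail_le.
  - exact: mm_rate_tailS_le.
split.
- move=> L N p phi m L2 p_prob p_irr p_col phi0 fin.
  by apply: stationary_lawP => //; exact: ltnW.
- by rewrite hb phi_c_pi_b// ltry.
- by rewrite hb phi_c_pi_b//; exact: partition_function1_lt.
- move=> [//|n] phi _ phi0 fin; rewrite hb phi_c_pi_b//=.
  by apply: lowest_weak_cvg => //; rewrite -hb.
Qed.
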